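(* Let $N=n+1$ and let $\varepsilon_l(N)=\pi G_n-\left\{\ln(16N)+\gamma+\sum_{k=1}^{l}\frac{\alpha_k}{N^k}\right\}$ be the error due to truncating the asymptotic expansion of $\pi G_n$ at the $l$-th order term. Then $$(-1)^{\frac{l(l+1)}{2}}\,\varepsilon_l(N)<0$$ for all $l=0,1,2,\dots$ and all $n=0,1,2,\dots$.
   Context: The Landau constants are $G_0=1$ and $G_n=1+\left(\frac12\right)^2+\left(\frac{1\cdot 3}{2\cdot 4}\right)^2+\cdots+\left(\frac{1\cdot3\cdots(2n-1)}{2\cdot4\cdots(2n)}\right)^2$ for $n=1,2,\dots$. Write $N=n+1$, and let $\gamma=0.577215\ldots$ be Euler's constant. It is known that there are (unique) real constants $\alpha_1,\alpha_2,\dots$ such that, as $n\to\infty$, $\pi G_n\sim \ln(16N)+\gamma+\sum_{k=1}^\infty\frac{\alpha_k}{N^k}$; that is, for every integer $m\ge 0$, $\pi G_n=\ln(16N)+\gamma+\sum_{k=1}^m\frac{\alpha_k}{N^k}+O(N^{-m-1})$ as $n\to\infty$. Empty sums are zero. *)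

(* Defs.v *)
From Stdlib Require Import Reals.
From Coquelicot Require Import Coquelicot.

Open Scope R_scope.

(* (1*3*...*(2k-1)) / (2*4*...*(2k)), equal to 1 for k = 0. *)
Fixpoint odd_even_ratio (k : nat) : R :=
  match k with
  | O => 1
  | S j => odd_even_ratio j * (INR (2 * k - 1) / INR (2 * k))
  end.

Definition landau_G (n : nat) : R :=
  sum_f_R0 (fun k => odd_even_ratio k ^ 2) n.

(* The term at n = 0 is irrelevant to the limit. *)
Definition euler_gamma : R :=
  real (Lim_seq (fun n => sum_n_m (fun k => / INR k) 1 n - ln (INR n))).

(* The error eps_l(N) at N = n + 1. [sum_n_m a 1 0] is the empty sum 0, and
   the value [alpha 0] is never used. *)
Definition landau_error (alpha : nat -> R) (l n : nat) : R :=
  let N := INR (n + 1) in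
  PI * landau_G n
  - (ln (16 * N) + euler_gamma + sum_n_m (fun k => alpha k / N ^ k) 1 l).

(* pi G_n ~ ln(16 N) + gamma + sum_{k >= 1} alpha_k / N^k as n -> oo: for every
   order m the truncation error is O(N^(-m-1)), the constant depending on m. *)
Definition is_landau_expansion (alpha : nat -> R) : Prop :=
  forall m : nat, exists C : R,
    eventually (fun n : nat =>
      Rabs (landau_error alpha m n) <= C / INR (n + 1) ^ (m + 1)).

(* Main.v *)
(** With N = n + 1, the recurrence N^2 I_N = (N - 1/2)^2 I_(N-1) satisfied by
    I_N = pi (G_N - G_(N-1)) is solved by a Laplace transform, and in the
    variable q (Laplace parameter 4 N) the error of order 0 is
      pi G_n - ln (16 N) - gamma = Int_0^oo e^(-4 N q) (w q - y q) dq,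
      w = 1/q - h/sinh q,   y = h/cosh q,   h = P_(-1/2)(cosh (2 q)),
    where h is even, so that w and y are the odd and even parts of the kernel.
    Truncating the asymptotic expansion amounts to truncating the Taylor series
    of the kernel.

    Call an even function alternating if its Taylor remainders in q^2 alternate
    in sign for all q.  Alternating functions are closed under sums, products,
    dilations by u, mixtures, and the shift f |-> (f 0 - f q)/q^2.  The Green's
    function of -d^2/du^2 shows that sinh (u q)/sinh q is alternating, and from
    this the differential equation of h yields, order by order, that h is. Hence
    y and w/q are alternating, which settles truncation after an odd order,
    where the contributions of y and w have the same sign.

    After an even order the signs conflict.  Integrating w by parts replaces it
    by w'/(4 N), and 4 y - w' = 2 y + E with E alternating, so that y wins.
    The coefficients alpha_k are identified by uniqueness of asymptotic
    expansions, and the constants gamma and ln 16 never need to be computed: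
    the error tends to 0 by hypothesis. *)

Require Import Defs.
From Stdlib Require Import Reals.
From Coquelicot Require Import Coquelicot.
From Stdlib Require Import Lra Lia Psatz Factorial.
Open Scope R_scope.

(** The kernel comes from summing a geometric series: [(1 - exp (-4 q)) (1/sinh q + 1/cosh q) = 4
    exp (- q)], so [h/sinh q + h/cosh q] is the density of the increments of [PI G] divided by
    [1 - exp (-4 q)], and [1/q] plays the same part for the increments of the logarithm (Frullani's
    integral).

    The Taylor series of the kernel has a finite radius of convergence, since [cosh q] vanishes at
    [q = i PI/2], while the Laplace integral runs over the whole half-line. Signs of remainders can
    therefore not be read off the series; they are carried through exact identities in which each
    term is visibly nonnegative.

    For even orders the margin matters. If [c y - w'] is alternating, integration by parts leaves
    [y] with the coefficient [1 - c/(4 N)]. The value [c = 2] keeps it at least [1/2] for every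
    [N >= 1], so that [n = 0] is no exception. *)

(** * Continuity and Riemann integrals *)

Definition cont (f : R -> R) : Prop := forall x, continuous f x.

Lemma cont_const (c : R) : cont (fun _ => c).
Proof. intros x; apply continuous_const. Qed.

Lemma cont_id : cont (fun x => x).
Proof. intros x; apply continuous_id. Qed.

Lemma cont_plus (f g : R -> R) : cont f -> cont g -> cont (fun x => f x + g x).
Proof. intros Hf Hg x; apply (continuous_plus f g); auto. Qed.

Lemma cont_minus (f g : R -> R) : cont f -> cont g -> cont (fun x => f x - g x).
Proof. intros Hf Hg x; apply (continuous_minus f g); auto. Qed.

Lemma cont_mult (f g : R -> R) : cont f -> cont g -> cont (fun x => f x * g x).
Proof. intros Hf Hg x; apply (continuous_mult f g); auto. Qed.

Lemma cont_comp (f g : R -> R) : cont f -> cont g -> cont (fun x => g (f x)).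
Proof. intros Hf Hg x; apply (continuous_comp f g); auto. Qed.

Lemma cont_div (f g : R -> R) :
  cont f -> cont g -> (forall x, g x <> 0) -> cont (fun x => f x / g x).
Proof.
intros Hf Hg Hn x; unfold Rdiv.
apply (continuous_mult f (fun x => / g x)); auto.
apply continuous_comp; auto.
apply continuous_Rinv; auto.
Qed.

Lemma cont_pow (f : R -> R) (n : nat) : cont f -> cont (fun x => f x ^ n).
Proof.
intros Hf; induction n as [|n IH]; simpl.
- apply cont_const.
- now apply cont_mult.
Qed.

Lemma cont_of_derive (f df : R -> R) :
  (forall x, is_derive f x (df x)) -> cont f.
Proof. intros H x; apply (@ex_derive_continuous R_AbsRing R_NormedModule f x); eexists; apply H. Qed.

Lemma cont_ext (f g : R -> R) : (forall x, f x = g x) -> cont f -> cont g.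
Proof. intros H Hf x; apply (continuous_ext f g); auto. Qed.

Lemma cont_exp : cont exp.
Proof. apply (cont_of_derive _ exp); intros; apply is_derive_exp. Qed.

Lemma is_derive_sinh (x : R) : is_derive sinh x (cosh x).
Proof. apply is_derive_Reals, derivable_pt_lim_sinh. Qed.

Lemma is_derive_cosh (x : R) : is_derive cosh x (sinh x).
Proof. apply is_derive_Reals, derivable_pt_lim_cosh. Qed.

Lemma cont_sinh : cont sinh.
Proof. apply (cont_of_derive _ cosh is_derive_sinh). Qed.

Lemma cont_cosh : cont cosh.
Proof. apply (cont_of_derive _ sinh is_derive_cosh). Qed.

Lemma cont_sum (f : nat -> R -> R) (n : nat) :
  (forall k, cont (f k)) -> cont (fun x => sum_f_R0 (fun k => f k x) n).
Proof.
intros H; induction n as [|n IH]; simpl; auto.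
now apply cont_plus.
Qed.

Create HintDb cont.
#[global] Hint Resolve cont_const cont_id cont_plus cont_minus cont_mult
  cont_pow cont_exp cont_sinh cont_cosh cont_sum : cont.

Lemma ex_RInt_cont (f : R -> R) (a b : R) : cont f -> ex_RInt f a b.
Proof. intros H; apply (ex_RInt_continuous (V:=R_CompleteNormedModule)); auto. Qed.

Lemma RInt_Rplus (f g : R -> R) (a b : R) : ex_RInt f a b -> ex_RInt g a b ->
  RInt (fun x => f x + g x) a b = RInt f a b + RInt g a b.
Proof. intros; now apply (RInt_plus (V:=R_CompleteNormedModule)). Qed.

Lemma RInt_Rminus (f g : R -> R) (a b : R) : ex_RInt f a b -> ex_RInt g a b ->
  RInt (fun x => f x - g x) a b = RInt f a b - RInt g a b.
Proof. intros; now apply (RInt_minus (V:=R_CompleteNormedModule)). Qed.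

Lemma RInt_Rscal (f : R -> R) (a b l : R) : ex_RInt f a b ->
  RInt (fun x => l * f x) a b = l * RInt f a b.
Proof. intros; now apply (RInt_scal (V:=R_CompleteNormedModule)). Qed.

Lemma RInt_Rchasles (f : R -> R) (a b c : R) : cont f ->
  RInt f a b + RInt f b c = RInt f a c.
Proof.
intros; apply (RInt_Chasles (V:=R_CompleteNormedModule)); now apply ex_RInt_cont.
Qed.

Lemma is_derive_RInt_cont (f : R -> R) (a x : R) :
  cont f -> is_derive (fun x => RInt f a x) x (f x).
Proof.
intros H; apply (is_derive_RInt f (RInt f a) a x); auto.
apply filter_forall; intros y.
apply (RInt_correct (V:=R_CompleteNormedModule)); now apply ex_RInt_cont.
Qed.

Lemma cont_RInt (f : R -> R) (a : R) : cont f -> cont (fun x => RInt f a x).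
Proof.
intros H; apply (cont_of_derive _ f); intros; now apply is_derive_RInt_cont.
Qed.

Lemma RInt_eq (f g : R -> R) (a b : R) :
  (forall x, f x = g x) -> RInt f a b = RInt g a b.
Proof. intros H; apply (RInt_ext (V:=R_CompleteNormedModule)); auto. Qed.

Lemma RInt_Rext (f g : R -> R) (a b : R) : a <= b ->
  (forall x, a < x < b -> f x = g x) -> RInt f a b = RInt g a b.
Proof.
intros Hab H; apply (RInt_ext (V:=R_CompleteNormedModule)).
rewrite Rmin_left, Rmax_right; auto.
Qed.

(* The derivative is only required on the open interval, which is what
   removable singularities at 0 call for. *)
Lemma RInt_ftc_open (F f : R -> R) (a b : R) : a <= b -> cont f ->
  (forall x, a < x < b -> is_derive F x (f x)) ->
  (forall x, a <= x <= b -> continuous F x) ->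
  RInt f a b = F b - F a.
Proof.
intros Hab Hf HD HC.
destruct (MVT_gen (fun x => F x - RInt f a x) a b (fun _ => 0)) as [c [_ Hc]].
- rewrite Rmin_left, Rmax_right; auto; intros x Hx.
  replace 0 with (f x - f x) by ring.
  apply (@is_derive_minus R_AbsRing R_NormedModule); auto.
  now apply is_derive_RInt_cont.
- rewrite Rmin_left, Rmax_right; auto; intros x Hx.
  apply continuity_pt_filterlim.
  apply (continuous_minus F (RInt f a)); auto.
  now apply cont_RInt.
- rewrite RInt_point in Hc; unfold zero in Hc; simpl in Hc; lra.
Qed.

(** Turns an integral up to [q] into a mixture of dilations over the fixed interval [[0, 1]], the
    form that [alt_mix] accepts. *)
Lemma RInt_dilate (f : R -> R) (q : R) : cont f ->
  q * RInt (fun u => f (u * q)) 0 1 = RInt f 0 q.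
Proof.
intros H.
rewrite <- RInt_Rscal.
- replace (RInt f 0 q) with (RInt f (q * 0 + 0) (q * 1 + 0)) by (f_equal; ring).
  rewrite <- (RInt_comp_lin (V:=R_CompleteNormedModule)) by now apply ex_RInt_cont.
  apply RInt_eq; intros x; unfold scal; simpl; unfold mult; simpl.
  do 2 f_equal; ring.
- apply ex_RInt_cont, (cont_comp (fun u => u * q) f); auto with cont.
Qed.

(** * Alternating Taylor remainders in [q^2] *)

(* [rem a f j q = (-1)^j (f q - sum_(i < j) (-1)^i a_i q^(2 i))]. *)
Fixpoint rem (a : nat -> R) (f : R -> R) (j : nat) (q : R) : R :=
  match j with
  | O => f q
  | S i => a i * (q ^ 2) ^ i - rem a f i q
  end.

Definition alt (J : nat) (a : nat -> R) (f : R -> R) : Prop :=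
  forall j, (j <= J)%nat -> forall q, 0 <= rem a f j q.

Lemma rem_ext (a b : nat -> R) (f g : R -> R) (j : nat) (q : R) :
  (forall i, (i < j)%nat -> a i = b i) -> f q = g q -> rem a f j q = rem b g j q.
Proof.
intros Ha Hf; induction j as [|j IH]; simpl; auto.
rewrite IH, Ha; auto.
Qed.

Lemma rem_plus (a b : nat -> R) (f g : R -> R) (j : nat) (q : R) :
  rem (fun i => a i + b i) (fun q => f q + g q) j q = rem a f j q + rem b g j q.
Proof. induction j as [|j IH]; simpl; [|rewrite IH]; ring. Qed.

Lemma rem_scal (l : R) (a : nat -> R) (f : R -> R) (j : nat) (q : R) :
  rem (fun i => l * a i) (fun q => l * f q) j q = l * rem a f j q.
Proof. induction j as [|j IH]; simpl; [|rewrite IH]; ring. Qed.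

Lemma rem_dilate (u : R) (a : nat -> R) (f : R -> R) (j : nat) (q : R) :
  rem (fun i => (u ^ 2) ^ i * a i) (fun q => f (u * q)) j q = rem a f j (u * q).
Proof.
induction j as [|j IH]; [reflexivity|].
cbn [rem]; rewrite IH, !Rpow_mult_distr; ring.
Qed.

Lemma rem_shift (a : nat -> R) (f g : R -> R) (j : nat) (q : R) :
  f q = a O - q ^ 2 * g q ->
  rem a f (S j) q = q ^ 2 * rem (fun i => a (S i)) g j q.
Proof.
intros H; induction j as [|j IH].
- simpl; rewrite H; simpl; ring.
- change (rem a f (S (S j)) q) with (a (S j) * (q ^ 2) ^ (S j) - rem a f (S j) q).
  rewrite IH; simpl; ring.
Qed.

(** Replace [f] by its Taylor polynomial plus remainder: the term of order [k] multiplies [g], whose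
    own expansion then stops at order [S j - k]. All signs agree, so for alternating factors every
    summand on the right is nonnegative. *)
Lemma rem_mul (a b : nat -> R) (f g : R -> R) (j : nat) (q : R) :
  rem (fun i => sum_f_R0 (fun k => a k * b (i - k)%nat) i)
      (fun q => f q * g q) (S j) q
  = sum_f_R0 (fun k => a k * (q ^ 2) ^ k * rem b g (S j - k) q) j
    + rem a f (S j) q * g q.
Proof.
induction j as [|j IH].
- simpl; ring.
- set (c := fun i : nat => sum_f_R0 (fun k => a k * b (i - k)%nat) i) in *.
  change (rem c (fun q => f q * g q) (S (S j)) q)
    with (c (S j) * (q ^ 2) ^ (S j) - rem c (fun q => f q * g q) (S j) q).
  rewrite IH.
  change (rem a f (S (S j)) q) with (a (S j) * (q ^ 2) ^ (S j) - rem a f (S j) q).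
  assert (E : sum_f_R0 (fun k => a k * (q ^ 2) ^ k * rem b g (S (S j) - k) q) j
     = sum_f_R0 (fun k => a k * b (S j - k)%nat) j * (q ^ 2) ^ (S j)
       - sum_f_R0 (fun k => a k * (q ^ 2) ^ k * rem b g (S j - k) q) j).
  { rewrite (Rmult_comm _ ((q ^ 2) ^ S j)), scal_sum.
    rewrite <- minus_sum; apply sum_eq; intros k Hk.
    replace (S (S j) - k)%nat with (S (S j - k)) by lia.
    cbn [rem].
    replace ((q ^ 2) ^ S j) with ((q ^ 2) ^ k * (q ^ 2) ^ (S j - k)).
    - generalize ((q ^ 2) ^ k) ((q ^ 2) ^ (S j - k)); intros; ring.
    - rewrite <- pow_add; f_equal; lia. }
  rewrite (tech5 _ j), E.
  replace (S (S j) - S j)%nat with 1%nat by lia.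
  unfold c; rewrite (tech5 _ j), Nat.sub_diag; cbn [rem]; ring.
Qed.

Lemma alt_le (J J' : nat) (a : nat -> R) (f : R -> R) :
  (J <= J')%nat -> alt J' a f -> alt J a f.
Proof. intros H Ha j Hj; apply Ha; lia. Qed.

(** Two consecutive remainders add up to the term [a k * (q ^ 2) ^ k], which at [q = 1] is the
    coefficient. *)
Lemma alt_coef_ge0 (J : nat) (a : nat -> R) (f : R -> R) (k : nat) :
  alt J a f -> (k < J)%nat -> 0 <= a k.
Proof.
intros H Hk.
generalize (H k ltac:(lia) 1) (H (S k) ltac:(lia) 1); cbn [rem].
rewrite pow1, pow1; lra.
Qed.

Lemma alt_rem_le (J : nat) (a : nat -> R) (f : R -> R) (k : nat) (q : R) :
  alt J a f -> (k < J)%nat -> rem a f k q <= a k * (q ^ 2) ^ k.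
Proof. intros H Hk; generalize (H (S k) ltac:(lia) q); cbn [rem]; lra. Qed.

(** At 0 the remainders of orders 1 and 2 are opposite numbers, and both are nonnegative. *)
Lemma alt_at0 (J : nat) (a : nat -> R) (f : R -> R) :
  alt (S (S J)) a f -> f 0 = a O.
Proof.
intros H; generalize (H 1%nat ltac:(lia) 0) (H 2%nat ltac:(lia) 0); simpl; lra.
Qed.

(** Orders 1 and 2 give [0 <= a 0 - f y <= a 1 * y ^ 2]. Alternation thus supplies continuity at
    removable singularities. *)
Lemma alt_continuous0 (J : nat) (a : nat -> R) (f : R -> R) :
  alt (S (S J)) a f -> continuous f 0.
Proof.
intros H.
apply (filterlim_locally f); intros eps.
rewrite (alt_at0 J a f H).
assert (Ha : 0 <= a 1%nat) by (eapply alt_coef_ge0; eauto; lia).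
assert (Hd : 0 < Rmin 1 (eps / (a 1%nat + 1))).
{ apply Rmin_pos; [lra|apply Rdiv_lt_0_compat; [apply cond_pos|lra]]. }
exists (mkposreal _ Hd); intros y Hy.
unfold ball in *; simpl in *; unfold AbsRing_ball, abs, minus, plus, opp in *; simpl in *.
rewrite Ropp_0, Rplus_0_r in Hy.
assert (H1 := H 1%nat ltac:(lia) y).
assert (H2 := alt_rem_le _ a f 1%nat y H ltac:(lia)); simpl in H1, H2.
rewrite !Rmult_1_r in *.
rewrite Rabs_left1 by lra.
assert (Hy1 : Rabs y < 1) by (eapply Rlt_le_trans; [apply Hy|apply Rmin_l]).
assert (Hy2 : Rabs y < eps / (a 1%nat + 1)) by (eapply Rlt_le_trans; [apply Hy|apply Rmin_r]).
apply Rlt_div_r in Hy2; [|lra].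
assert (y * y <= Rabs y).
{ rewrite <- (Rabs_pos_eq (y * y)) by nra; rewrite Rabs_mult.
  generalize (Rabs_pos y); nra. }
generalize (Rabs_pos y) (cond_pos eps); nra.
Qed.

Lemma alt_ext (J : nat) (a : nat -> R) (f g : R -> R) :
  (forall q, f q = g q) -> alt J a f -> alt J a g.
Proof.
intros E H j Hj q; rewrite <- (rem_ext a a f g); auto.
Qed.

Lemma alt_plus (J : nat) (a b : nat -> R) (f g : R -> R) :
  alt J a f -> alt J b g -> alt J (fun i => a i + b i) (fun q => f q + g q).
Proof.
intros Hf Hg j Hj q; rewrite rem_plus.
specialize (Hf j Hj q); specialize (Hg j Hj q); lra.
Qed.

Lemma alt_scal (J : nat) (l : R) (a : nat -> R) (f : R -> R) :
  0 <= l -> alt J a f -> alt J (fun i => l * a i) (fun q => l * f q).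
Proof. intros Hl H j Hj q; rewrite rem_scal; apply Rmult_le_pos; auto. Qed.

Lemma alt_dilate (J : nat) (u : R) (a : nat -> R) (f : R -> R) :
  alt J a f -> alt J (fun i => (u ^ 2) ^ i * a i) (fun q => f (u * q)).
Proof. intros H j Hj q; rewrite rem_dilate; auto. Qed.

Lemma pow2_pow_ge0 (q : R) (k : nat) : 0 <= (q ^ 2) ^ k.
Proof. apply pow_le, pow2_ge_0. Qed.

Lemma sum_f_R0_ge0 (f : nat -> R) (n : nat) :
  (forall k, (k <= n)%nat -> 0 <= f k) -> 0 <= sum_f_R0 f n.
Proof.
induction n as [|n IH]; intros H; simpl; auto.
apply Rplus_le_le_0_compat; auto.
Qed.

(** Isolates one summand of [rem_mul], so that strict positivity for one factor passes to the
    product. *)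
Lemma rem_mul_ge (J : nat) (a b : nat -> R) (f g : R -> R) :
  alt J a f -> alt J b g -> forall j, (j <= J)%nat -> forall q,
  rem a f j q * g q <=
  rem (fun i => sum_f_R0 (fun k => a k * b (i - k)%nat) i)
      (fun q => f q * g q) j q.
Proof.
intros Hf Hg [|j] Hj q.
- simpl; lra.
- rewrite rem_mul.
  assert (0 <= sum_f_R0 (fun k => a k * (q ^ 2) ^ k * rem b g (S j - k) q) j).
  { apply sum_f_R0_ge0; intros k Hk.
    apply Rmult_le_pos; [apply Rmult_le_pos|].
    - apply (alt_coef_ge0 J a f); [assumption|lia].
    - apply pow2_pow_ge0.
    - apply Hg; lia. }
  lra.
Qed.

Lemma alt_mul (J : nat) (a b : nat -> R) (f g : R -> R) :
  alt J a f -> alt J b g ->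
  alt J (fun i => sum_f_R0 (fun k => a k * b (i - k)%nat) i) (fun q => f q * g q).
Proof.
intros Hf Hg j Hj q.
eapply Rle_trans; [|eapply rem_mul_ge; eauto].
apply Rmult_le_pos; [apply Hf; auto|apply (Hg 0%nat); lia].
Qed.

(* The value at 0 is the limit when [a] lists the Taylor coefficients of [f]. *)
Definition shift (a : nat -> R) (f : R -> R) (q : R) : R :=
  if Req_EM_T q 0 then a 1%nat else (a O - f q) / q ^ 2.

Lemma shiftE (J : nat) (a : nat -> R) (f : R -> R) (q : R) :
  alt (S (S J)) a f -> f q = a O - q ^ 2 * shift a f q.
Proof.
intros H; unfold shift; destruct (Req_EM_T q 0) as [->|Hq].
- rewrite (alt_at0 J a f H); ring.
- field; auto.
Qed.

(** The factor [q ^ 2] turns order [J] of [g] into order [S J] of [f]; inductions on the order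
    advance through this step. *)
Lemma alt_of_factor (J : nat) (a : nat -> R) (f g : R -> R) :
  (forall q, f q = a O - q ^ 2 * g q) -> (forall q, 0 <= f q) ->
  alt J (fun i => a (S i)) g -> alt (S J) a f.
Proof.
intros E H0 Hg [|j] Hj q; [apply H0|].
rewrite (rem_shift a f g j q) by auto.
apply Rmult_le_pos; [apply pow2_ge_0|apply Hg; lia].
Qed.

Lemma alt_shift (J : nat) (a : nat -> R) (f : R -> R) :
  alt (S (S J)) a f -> alt (S J) (fun i => a (S i)) (shift a f).
Proof.
intros H j Hj q.
destruct (Req_dec q 0) as [->|Hq].
- assert (E : shift a f 0 = a 1%nat) by
    (unfold shift; destruct (Req_EM_T 0 0); auto; lra).
  destruct j as [|j]; [simpl; rewrite E; eapply alt_coef_ge0; eauto; lia|].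
  (* At 0 all remainders of positive order vanish, since [shift a f 0] is the coefficient itself. *)
  clear Hj; apply Req_le; symmetry.
  induction j as [|j IH]; [simpl; rewrite E; ring|].
  change (rem (fun i => a (S i)) (shift a f) (S (S j)) 0) with
    (a (S (S j)) * (0 ^ 2) ^ (S j) - rem (fun i => a (S i)) (shift a f) (S j) 0).
  rewrite IH; simpl; ring.
- assert (Hr := rem_shift a f (shift a f) j q (shiftE J a f q H)).
  assert (H1 := H (S j) ltac:(lia) q); rewrite Hr in H1.
  assert (0 < q ^ 2) by (apply pow2_gt_0; auto).
  apply Rmult_le_reg_l with (q ^ 2); auto; lra.
Qed.

(** The remainder is linear in the pair of coefficients and function, hence commutes with the
    integral over [u]. *)
Lemma alt_mix (J : nat) (a : R -> nat -> R) (f : R -> R -> R) :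
  (forall u, 0 < u < 1 -> alt J (a u) (f u)) ->
  (forall q, ex_RInt (fun u => f u q) 0 1) ->
  (forall i, ex_RInt (fun u => a u i) 0 1) ->
  alt J (fun i => RInt (fun u => a u i) 0 1) (fun q => RInt (fun u => f u q) 0 1).
Proof.
intros H Hf Ha j Hj q.
assert (E : forall j, ex_RInt (fun u => rem (a u) (f u) j q) 0 1 /\
  rem (fun i => RInt (fun u => a u i) 0 1) (fun q => RInt (fun u => f u q) 0 1) j q
  = RInt (fun u => rem (a u) (f u) j q) 0 1).
{ clear j Hj; intros j; induction j as [|j [IH1 IH2]].
  - split; [apply Hf|reflexivity].
  - assert (Hi : ex_RInt (fun u => (q ^ 2) ^ j * a u j) 0 1).
    { apply (ex_RInt_scal (V:=R_NormedModule)); auto. }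
    cbn [rem]; split.
    + apply (ex_RInt_ext (V:=R_NormedModule)
        (fun u => (q ^ 2) ^ j * a u j - rem (a u) (f u) j q)).
      * intros u _; apply (f_equal2 Rminus); [apply Rmult_comm|reflexivity].
      * now apply (ex_RInt_minus (V:=R_NormedModule)).
    + rewrite (RInt_Rext (fun u => a u j * (q ^ 2) ^ j - rem (a u) (f u) j q)
        (fun u => (q ^ 2) ^ j * a u j - rem (a u) (f u) j q));
        [|lra|intros; ring].
      rewrite RInt_Rminus, RInt_Rscal, IH2 by auto; ring. }
destruct (E j) as [E1 ->].
apply RInt_ge_0; [lra|auto|].
intros u Hu; apply H; auto.
Qed.

(** * Hyperbolic kernels *)

Lemma cosh_gt0 (x : R) : 0 < cosh x.
Proof. unfold cosh; generalize (exp_pos x) (exp_pos (- x)); lra. Qed.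

Lemma sinh_gt0 (x : R) : 0 < x -> 0 < sinh x.
Proof. intros H; rewrite <- sinh_0; now apply sinh_lt. Qed.

Lemma sinh_opp (x : R) : sinh (- x) = - sinh x.
Proof. unfold sinh; rewrite Ropp_involutive; lra. Qed.

Lemma sinh_neq0 (x : R) : x <> 0 -> sinh x <> 0.
Proof.
intros H; destruct (Rtotal_order x 0) as [Hx|[Hx|Hx]]; [|lra|].
- generalize (sinh_gt0 (- x)); rewrite sinh_opp; lra.
- generalize (sinh_gt0 x); lra.
Qed.

Lemma cosh2_sinh2 (x : R) : cosh x ^ 2 = 1 + sinh x ^ 2.
Proof.
unfold cosh, sinh; generalize (exp_plus x (- x)); rewrite Rplus_opp_r, exp_0; intros; nra.
Qed.

Lemma sinh_2x (x : R) : sinh (2 * x) = 2 * (sinh x * cosh x).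
Proof.
unfold sinh, cosh; replace (2 * x) with (x + x) by ring.
rewrite Ropp_plus_distr, !exp_plus; field.
Qed.

Lemma cosh_2x (x : R) : cosh (2 * x) = 1 + 2 * sinh x ^ 2.
Proof.
generalize (exp_plus x (- x)); rewrite Rplus_opp_r, exp_0; intros E.
unfold sinh, cosh; replace (2 * x) with (x + x) by ring.
rewrite Ropp_plus_distr, !exp_plus; nra.
Qed.

(* Green's operator of [- d^2/du^2] on [0, 1] with Dirichlet conditions. *)
Definition green (f : R -> R) (u : R) : R :=
  (1 - u) * RInt (fun w => w * f w) 0 u + u * RInt (fun w => (1 - w) * f w) u 1.

Lemma green_cont (f : R -> R) : cont f -> cont (green f).
Proof.
intros Hf.
assert (H1 : cont (fun w => w * f w)) by auto with cont.
assert (H2 : cont (fun w => (1 - w) * f w)) by auto with cont.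
apply (cont_ext (fun u => (1 - u) * RInt (fun w => w * f w) 0 u +
  u * (RInt (fun w => (1 - w) * f w) 0 1 - RInt (fun w => (1 - w) * f w) 0 u))).
- intros u; unfold green.
  rewrite <- (RInt_Rchasles (fun w => (1 - w) * f w) 0 u 1) by auto; ring.
- assert (cont (fun u => RInt (fun w => w * f w) 0 u)) by now apply cont_RInt.
  assert (cont (fun u => RInt (fun w => (1 - w) * f w) 0 u)) by now apply cont_RInt.
  auto with cont.
Qed.

Lemma green_gt0 (f : R -> R) (u : R) : cont f ->
  (forall w, 0 < w < 1 -> 0 < f w) -> 0 < u < 1 -> 0 < green f u.
Proof.
intros Hc Hf Hu.
assert (H1 : cont (fun w => w * f w)) by auto with cont.
assert (H2 : cont (fun w => (1 - w) * f w)) by auto with cont.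
apply Rplus_lt_0_compat; apply Rmult_lt_0_compat; try lra; apply RInt_gt_0; auto; try lra;
  intros w Hw; apply Rmult_lt_0_compat; try apply Hf; lra.
Qed.

(** The shape [f w * l - g w] is the one in which [rem] unfolds. *)
Lemma green_lin (l : R) (f g : R -> R) (u : R) : cont f -> cont g ->
  green (fun w => f w * l - g w) u = l * green f u - green g u.
Proof.
intros Hf Hg; unfold green.
assert (E : forall a : R -> R, cont a -> forall x y,
  RInt (fun w => a w * (f w * l - g w)) x y =
  l * RInt (fun w => a w * f w) x y - RInt (fun w => a w * g w) x y).
{ intros a Ha x y.
  rewrite <- RInt_Rscal, <- RInt_Rminus by (apply ex_RInt_cont; auto with cont).
  apply RInt_eq; intros; ring. }
rewrite (E (fun w => w)), (E (fun w => 1 - w)) by auto with cont; ring.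
Qed.

(** The solution of [v'' = q^2 v] with [v 0 = 0] and [v 1 = 1], as a function of [u]. *)
Definition sinh_ratio (q u : R) : R :=
  if Req_EM_T q 0 then u else sinh (u * q) / sinh q.

Lemma sinh_ratio_cont (q : R) : cont (sinh_ratio q).
Proof.
unfold sinh_ratio; destruct (Req_EM_T q 0) as [_|Hq]; auto with cont.
apply cont_div; auto with cont.
- apply (cont_comp (fun u => u * q) sinh); auto with cont.
- intros _; now apply sinh_neq0.
Qed.
#[global] Hint Resolve sinh_ratio_cont green_cont : cont.

Lemma sinh_ratio_gt0 (q u : R) : 0 < u < 1 -> 0 < sinh_ratio q u.
Proof.
intros Hu; unfold sinh_ratio; destruct (Req_EM_T q 0) as [_|Hq]; [lra|].
destruct (Rtotal_order q 0) as [H|[H|H]]; [|lra|].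
- replace (sinh (u * q) / sinh q) with (sinh (u * - q) / sinh (- q)).
  + apply Rdiv_lt_0_compat; apply sinh_gt0; nra.
  + rewrite <- Ropp_mult_distr_r, !sinh_opp; field; now apply sinh_neq0.
- apply Rdiv_lt_0_compat; apply sinh_gt0; nra.
Qed.

(** The function [u - v] vanishes at 0 and 1 and satisfies [- (u - v)'' = q^2 v]. The proof
    evaluates both integrals by explicit antiderivatives. *)
Lemma sinh_ratio_green (q u : R) : 0 < u < 1 -> sinh_ratio q u = u - q ^ 2 * green (sinh_ratio q) u.
Proof.
intros Hu; unfold sinh_ratio at 1; destruct (Req_EM_T q 0) as [->|Hq]; [ring|].
assert (Hs := sinh_neq0 q Hq).
assert (Eratio : forall w, sinh_ratio q w = sinh (w * q) / sinh q).
{ intros w; unfold sinh_ratio; destruct (Req_EM_T q 0); [lra|auto]. }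
unfold green.
rewrite (RInt_ftc_open (fun w => (w * cosh (w * q) / q - sinh (w * q) / q ^ 2) / sinh q)),
 (RInt_ftc_open (fun w => ((1 - w) * cosh (w * q) / q + sinh (w * q) / q ^ 2) / sinh q)); try lra;
 auto with cont.
- rewrite (Rmult_1_l q), (Rmult_0_l q), sinh_0; field; auto.
- intros w _; rewrite Eratio.
  auto_derive; [auto|field; auto].
- intros w _; apply (@ex_derive_continuous R_AbsRing R_NormedModule).
  auto_derive; auto.
- intros w _; rewrite Eratio.
  auto_derive; [auto|field; auto].
- intros w _; apply (@ex_derive_continuous R_AbsRing R_NormedModule).
  auto_derive; auto.
Qed.

Fixpoint sinh_ratio_coef (i : nat) : R -> R :=
  match i with O => fun u => u | S i => green (sinh_ratio_coef i) end.

Lemma sinh_ratio_coef_cont (i : nat) : cont (sinh_ratio_coef i).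
Proof. induction i; simpl; auto with cont. Qed.
#[global] Hint Resolve sinh_ratio_coef_cont : cont.

Lemma rem_sinh_ratio_cont (q : R) (j : nat) :
  cont (fun u => rem (fun i => sinh_ratio_coef i u) (fun q => sinh_ratio q u) j q).
Proof. induction j; cbn [rem]; auto with cont. Qed.
#[global] Hint Resolve rem_sinh_ratio_cont : cont.

(** Iterating [sinh_ratio_green] expresses each remainder as a positive operator applied to the
    previous one, so positivity propagates to all orders. *)
Lemma rem_sinh_ratio (q u : R) (j : nat) : 0 < u < 1 ->
  rem (fun i => sinh_ratio_coef i u) (fun q => sinh_ratio q u) (S j) q =
  q ^ 2 * green (fun u => rem (fun i => sinh_ratio_coef i u) (fun q => sinh_ratio q u) j q) u.
Proof.
revert u; induction j as [|j IH]; intros u Hu.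
- cbn [rem]; rewrite sinh_ratio_green by auto.
  change (green (fun w => sinh_ratio q w) u) with (green (sinh_ratio q) u); simpl sinh_ratio_coef; ring.
- change (rem (fun i => sinh_ratio_coef i u) (fun q => sinh_ratio q u) (S (S j)) q) with
   (sinh_ratio_coef (S j) u * (q ^ 2) ^ (S j) - rem (fun i => sinh_ratio_coef i u) (fun q => sinh_ratio q u) (S j) q).
  rewrite IH by auto.
  cbn [rem].
  rewrite (green_lin _ (sinh_ratio_coef j)) by auto with cont; simpl; ring.
Qed.

Lemma rem_sinh_ratio_gt0 (q u : R) (j : nat) : q <> 0 -> 0 < u < 1 ->
  0 < rem (fun i => sinh_ratio_coef i u) (fun q => sinh_ratio q u) j q.
Proof.
intros Hq; revert u; induction j as [|j IH]; intros u Hu.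
- now apply sinh_ratio_gt0.
- rewrite rem_sinh_ratio by auto; apply Rmult_lt_0_compat; [now apply pow2_gt_0|].
  apply green_gt0; auto with cont.
Qed.

Lemma alt_sinh_ratio (J : nat) (u : R) : 0 < u < 1 ->
  alt J (fun i => sinh_ratio_coef i u) (fun q => sinh_ratio q u).
Proof.
intros Hu j _ q; destruct (Req_dec q 0) as [->|Hq].
- destruct j as [|j]; [apply Rlt_le, sinh_ratio_gt0; auto|].
  rewrite rem_sinh_ratio by auto; simpl; lra.
- now apply Rlt_le, rem_sinh_ratio_gt0.
Qed.

(** Coefficients read off [1/cosh q = 2 sinh q / sinh (2 q)]; the powers of 4 come from the dilation
    by 2. *)
Definition sechc (i : nat) : R := 2 * ((2 ^ 2) ^ i * sinh_ratio_coef i (1 / 2)).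

Lemma sechE (q : R) : / cosh q = 2 * sinh_ratio (2 * q) (1 / 2).
Proof.
unfold sinh_ratio; destruct (Req_EM_T (2 * q) 0) as [E|E].
- replace q with 0 by lra; rewrite cosh_0; field.
- rewrite sinh_2x; replace (1 / 2 * (2 * q)) with q by field.
  assert (sinh q <> 0) by (apply sinh_neq0; lra).
  assert (Hc := cosh_gt0 q); field; lra.
Qed.

Lemma rem_sech (j : nat) (q : R) : rem sechc (fun q => / cosh q) j q =
  2 * rem (fun i => sinh_ratio_coef i (1 / 2)) (fun q => sinh_ratio q (1 / 2)) j (2 * q).
Proof.
rewrite <- rem_dilate, <- rem_scal; apply rem_ext; auto using sechE.
Qed.

Lemma alt_sech (J : nat) : alt J sechc (fun q => / cosh q).
Proof.
intros j Hj q; rewrite rem_sech.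
apply Rmult_le_pos; [lra|apply (alt_sinh_ratio J (1 / 2)); auto; lra].
Qed.

Lemma rem_sech_gt0 (j : nat) (q : R) : q <> 0 -> 0 < rem sechc (fun q => / cosh q) j q.
Proof.
intros Hq; rewrite rem_sech.
apply Rmult_lt_0_compat; [lra|apply rem_sinh_ratio_gt0; lra].
Qed.

Definition qcsch (q : R) : R := if Req_EM_T q 0 then 1 else q / sinh q.

Definition qcschc (i : nat) : R :=
  match i with O => 1 | S i => RInt (fun w => (1 - w) * sinh_ratio_coef i w) 0 1 end.

(** This is [sinh_ratio_green] differentiated in [u] at [u = 0], where [sinh (u q)/sinh q] has slope
    [q/sinh q]. *)
Lemma qcschE (q : R) : qcsch q = 1 - q ^ 2 * RInt (fun w => (1 - w) * sinh_ratio q w) 0 1.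
Proof.
unfold qcsch; destruct (Req_EM_T q 0) as [->|Hq]; [ring|].
assert (Hs := sinh_neq0 q Hq).
assert (Eratio : forall w, sinh_ratio q w = sinh (w * q) / sinh q).
{ intros w; unfold sinh_ratio; destruct (Req_EM_T q 0); [lra|auto]. }
rewrite (RInt_ftc_open (fun w => ((1 - w) * cosh (w * q) / q + sinh (w * q) / q ^ 2) / sinh q)); try lra;
 auto with cont.
- rewrite (Rmult_1_l q), (Rmult_0_l q), sinh_0, cosh_0; field; auto.
- intros w _; rewrite Eratio.
  auto_derive; [auto|field; auto].
- intros w _; apply (@ex_derive_continuous R_AbsRing R_NormedModule).
  auto_derive; auto.
Qed.

Lemma alt_qcsch (J : nat) : alt J qcschc qcsch.
Proof.
apply (alt_le J (S J)); auto.
apply (alt_of_factor J qcschc qcsch (fun q => RInt (fun w => (1 - w) * sinh_ratio q w) 0 1)).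
- intros q; apply qcschE.
- intros q; unfold qcsch; destruct (Req_EM_T q 0) as [_|Hq]; [lra|].
  destruct (Rtotal_order q 0) as [H|[H|H]]; [|lra|].
  + replace (q / sinh q) with ((- q) / sinh (- q)).
    * apply Rlt_le, Rdiv_lt_0_compat; [|apply sinh_gt0]; lra.
    * rewrite sinh_opp; field; now apply sinh_neq0.
  + apply Rlt_le, Rdiv_lt_0_compat; [|apply sinh_gt0]; lra.
- apply (alt_mix J (fun w i => (1 - w) * sinh_ratio_coef i w) (fun w q => (1 - w) * sinh_ratio q w)).
  + intros u Hu; apply alt_scal; [lra|now apply alt_sinh_ratio].
  + intros q; apply ex_RInt_cont; auto with cont.
  + intros i; apply ex_RInt_cont; auto with cont.
Qed.

(** * Complete elliptic integrals and the conical function *)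

Lemma cont_sin : cont sin.
Proof. apply (cont_of_derive _ cos); intros x; auto_derive; auto; ring. Qed.

Lemma one_plus_sin2_gt0 (S t : R) : -1 < S -> 0 < 1 + S * sin t ^ 2.
Proof.
intros H; generalize (sin2_cos2 t) (pow2_ge_0 (sin t)) (pow2_ge_0 (cos t)); unfold Rsqr; simpl.
rewrite !Rmult_1_r; generalize (sin t * sin t) (cos t * cos t); intros s c.
destruct (Rle_lt_dec 0 S); nra.
Qed.

Lemma is_derive_RInt_sin2 (phi dphi : R -> R) (a b S : R) : -1 < S ->
  (forall x, 0 < x -> is_derive phi x (dphi x)) ->
  (forall x, 0 < x -> continuous dphi x) ->
  is_derive (fun S => RInt (fun t => phi (1 + S * sin t ^ 2)) a b) S
    (RInt (fun t => sin t ^ 2 * dphi (1 + S * sin t ^ 2)) a b).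
Proof.
intros HS Hd Hc.
assert (Hloc : locally S (fun y => -1 < y)).
{ apply (open_gt (-1)); auto. }
assert (D : forall y t, -1 < y ->
  is_derive (fun u => phi (1 + u * sin t ^ 2)) y (sin t ^ 2 * dphi (1 + y * sin t ^ 2))).
{ intros y t Hy.
  assert (H := Hd (1 + y * sin t ^ 2) (one_plus_sin2_gt0 y t Hy)).
  apply (is_derive_comp phi (fun u => 1 + u * sin t ^ 2)); auto.
  auto_derive; auto; simpl; ring. }
replace (RInt (fun t => sin t ^ 2 * dphi (1 + S * sin t ^ 2)) a b)
 with (RInt (fun t => Derive (fun u => phi (1 + u * sin t ^ 2)) S) a b).
2:{ apply RInt_eq; intros t; now apply is_derive_unique, D. }
apply (is_derive_RInt_param (fun S t => phi (1 + S * sin t ^ 2)) a b S).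
- eapply filter_imp; [|exact Hloc]; intros y Hy t _; eexists; now apply D.
- intros t _.
  apply (continuity_2d_pt_ext_loc (fun u v => sin v ^ 2 * dphi (1 + u * sin v ^ 2))).
  + destruct Hloc as [d Hd']; exists d; intros u v Hu _.
    symmetry; apply is_derive_unique, D, Hd', Hu.
  + assert (Hs : continuity_2d_pt (fun _ v => sin v ^ 2) S t).
    { apply (continuity_1d_2d_pt_comp (fun v => sin v ^ 2) (fun _ v => v)).
      - apply continuity_pt_filterlim, (cont_pow sin), cont_sin.
      - apply continuity_2d_pt_id2. }
    apply continuity_2d_pt_mult; auto.
    apply (continuity_1d_2d_pt_comp dphi (fun u v => 1 + u * sin v ^ 2)).
    * apply continuity_pt_filterlim, Hc; now apply one_plus_sin2_gt0.
    * apply continuity_2d_pt_plus; [apply continuity_2d_pt_const|].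
      apply continuity_2d_pt_mult; auto; apply continuity_2d_pt_id1.
- eapply filter_imp; [|exact Hloc]; intros y Hy.
  apply (ex_RInt_continuous (V:=R_CompleteNormedModule)); intros t _.
  apply (continuous_comp (fun t => 1 + y * sin t ^ 2) phi).
  + assert (Hs := cont_sin); assert (cont (fun t => 1 + y * sin t ^ 2)) by auto with cont; auto.
  + apply (@ex_derive_continuous R_AbsRing R_NormedModule); eexists.
    now apply Hd, one_plus_sin2_gt0.
Qed.

Definition Delta (S t : R) : R := sqrt (1 + S * sin t ^ 2).

Lemma Delta_gt0 (S t : R) : -1 < S -> 0 < Delta S t.
Proof. intros H; now apply sqrt_lt_R0, one_plus_sin2_gt0. Qed.

Lemma Delta_sqr (S t : R) : -1 < S -> Delta S t ^ 2 = 1 + S * sin t ^ 2.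
Proof. intros H; apply pow2_sqrt; generalize (one_plus_sin2_gt0 S t H); lra. Qed.

Lemma Delta_cont (S : R) : cont (Delta S).
Proof.
assert (Hs := cont_sin).
apply (cont_comp (fun t => 1 + S * sin t ^ 2) sqrt); auto with cont.
intros x; apply continuous_sqrt.
Qed.

Lemma Delta_inv_cont (S : R) : -1 < S -> cont (fun t => / Delta S t).
Proof.
intros HS x; apply continuous_comp; [apply Delta_cont|].
apply continuous_Rinv; generalize (Delta_gt0 S x HS); lra.
Qed.

(* Complete elliptic integrals with modulus [k^2 = - S], divided by [PI / 2]. *)
Definition ellK (S : R) : R := 2 / PI * RInt (fun t => / Delta S t) 0 (PI / 2).
Definition ellE (S : R) : R := 2 / PI * RInt (Delta S) 0 (PI / 2).

Lemma RInt_2_PI (c : R) : 2 / PI * RInt (fun _ => c) 0 (PI / 2) = c.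
Proof.
rewrite (RInt_const (V:=R_CompleteNormedModule)); unfold scal; simpl; unfold mult; simpl.
field; apply PI_neq0.
Qed.

Lemma ellK_0 : ellK 0 = 1.
Proof.
unfold ellK; rewrite <- (RInt_2_PI 1); f_equal; apply RInt_eq; intros t.
unfold Delta; rewrite Rmult_0_l, Rplus_0_r, sqrt_1; field.
Qed.

Lemma ellE_0 : ellE 0 = 1.
Proof.
unfold ellE; rewrite <- (RInt_2_PI 1); f_equal; apply RInt_eq; intros t.
unfold Delta; rewrite Rmult_0_l, Rplus_0_r, sqrt_1; field.
Qed.

Lemma ellK_gt0 (S : R) : -1 < S -> 0 < ellK S.
Proof.
intros HS; assert (HP := PI_RGT_0); apply Rmult_lt_0_compat.
- apply Rdiv_lt_0_compat; lra.
- apply RInt_gt_0; [lra| |].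
  + intros t _; now apply Rinv_0_lt_compat, Delta_gt0.
  + intros t _; now apply Delta_inv_cont.
Qed.

(** The equation is kept multiplied by [2 S], here and in [ellK_derive], so that it covers [S = 0],
    that is [q = 0]. *)
Lemma ellE_derive (S : R) : -1 < S ->
  exists d, is_derive ellE S d /\ 2 * S * d = ellE S - ellK S.
Proof.
intros HS.
exists (2 / PI * RInt (fun t => sin t ^ 2 * (/ (2 * sqrt (1 + S * sin t ^ 2)))) 0 (PI / 2)); split.
- apply is_derive_scal.
  apply (is_derive_RInt_sin2 sqrt (fun x => / (2 * sqrt x))); auto.
  + intros x Hx; auto_derive; auto; field; apply Rgt_not_eq, sqrt_lt_R0; auto.
  + intros x Hx; assert (0 < sqrt x) by now apply sqrt_lt_R0.
    apply continuous_comp; [|apply continuous_Rinv; lra].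
    apply (continuous_mult (fun _ => 2) sqrt); [apply continuous_const|apply continuous_sqrt].
- unfold ellE, ellK; rewrite <- Rmult_minus_distr_l.
  replace (2 * S * (2 / PI * RInt (fun t => sin t ^ 2 * (/ (2 * sqrt (1 + S * sin t ^ 2)))) 0 (PI / 2)))
   with (2 / PI * ((2 * S) * RInt (fun t => sin t ^ 2 * (/ (2 * sqrt (1 + S * sin t ^ 2)))) 0 (PI / 2))) by ring.
  f_equal.
  assert (Hs := cont_sin); assert (Hi := Delta_inv_cont S HS); assert (Hd := Delta_cont S).
  rewrite <- RInt_Rscal, <- RInt_Rminus.
  + apply RInt_eq; intros t; fold (Delta S t).
    assert (H1 := Delta_gt0 S t HS); assert (H2 := Delta_sqr S t HS).
    apply Rmult_eq_reg_r with (Delta S t); [|lra].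
    replace ((Delta S t - / Delta S t) * Delta S t) with (Delta S t ^ 2 - 1) by (field; lra).
    rewrite H2; field; lra.
  + apply ex_RInt_cont; auto.
  + apply ex_RInt_cont; auto.
  + apply ex_RInt_cont; apply (cont_ext (fun t => / 2 * (sin t ^ 2 * / Delta S t))); auto with cont.
    intros t; assert (H1 := Delta_gt0 S t HS); unfold Delta in *; field; lra.
Qed.

Lemma ellK_derive (S : R) : -1 < S ->
  exists d, is_derive ellK S d /\ 2 * S * (1 + S) * d = ellE S - (1 + S) * ellK S.
Proof.
intros HS.
set (I := fun t => sin t ^ 2 * (- / (2 * (1 + S * sin t ^ 2) * sqrt (1 + S * sin t ^ 2)))).
exists (2 / PI * RInt I 0 (PI / 2)).
assert (Hs := cont_sin); assert (Hi := Delta_inv_cont S HS); assert (Hd := Delta_cont S).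
assert (CI : cont I).
{ apply (cont_ext (fun t => - / 2 * (sin t ^ 2 * (/ Delta S t) ^ 3))); auto with cont.
  intros t; assert (H1 := Delta_gt0 S t HS); assert (H2 := Delta_sqr S t HS).
  unfold I; fold (Delta S t); rewrite <- H2; field; lra. }
split.
- apply is_derive_scal.
  apply (is_derive_RInt_sin2 (fun x => / sqrt x) (fun x => - / (2 * x * sqrt x))); auto.
  + intros x Hx; assert (Hx' : 0 < sqrt x) by now apply sqrt_lt_R0.
    auto_derive; [repeat split; auto; lra|].
    generalize (sqrt_sqrt x ltac:(lra)); intros E.
    rewrite E.
    field; lra.
  + intros x Hx; assert (Hx' : 0 < sqrt x) by now apply sqrt_lt_R0.
    apply (continuous_opp (fun x => / (2 * x * sqrt x))).
    apply continuous_comp; [|apply continuous_Rinv; nra].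
    apply (continuous_mult (fun x => 2 * x) sqrt); [|apply continuous_sqrt].
    apply (continuous_mult (fun _ => 2) (fun x => x));
      [apply continuous_const|apply continuous_id].
- assert (E : @eq R (RInt (fun t => (2 * S * (1 + S)) * I t -
      (Delta S t - (1 + S) * / Delta S t)) 0 (PI / 2)) 0).
  (* The two sides differ by the integral of an exact derivative, whose primitive vanishes at 0 and
     at [PI / 2]. *)
  { rewrite (RInt_ftc_open (fun t => S * (sin t * cos t / Delta S t))).
    - rewrite cos_PI2, sin_0; unfold Rdiv; ring.
    - generalize PI_RGT_0; lra.
    - auto with cont.
    - intros t _.
      assert (H1 := Delta_gt0 S t HS); assert (H2 := Delta_sqr S t HS).
      assert (H3 := one_plus_sin2_gt0 S t HS).
      unfold I; fold (Delta S t); rewrite <- H2.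
      unfold Delta at 1; auto_derive.
      + change (sqrt (1 + S * (sin t * (sin t * 1)))) with (Delta S t).
        repeat split; auto; lra.
      + change (sqrt (1 + S * (sin t * (sin t * 1)))) with (Delta S t).
        assert (Hc : cos t ^ 2 = 1 - sin t ^ 2) by
          (generalize (sin2_cos2 t); unfold Rsqr; simpl; lra).
        clear - H1 H2 Hc; set (D := Delta S t) in *; clearbody D.
        replace (S * ((1 * cos t * cos t + sin t * (1 * - sin t)) * / D +
          sin t * cos t * (- (S * (1 * cos t * ((1 + 1) * (sin t * 1))) * / (2 * D)) *
          / (D * D)))) with
          (S * ((cos t ^ 2 - sin t ^ 2) * D ^ 2 - S * sin t ^ 2 * cos t ^ 2) / D ^ 3)
          by (field; lra).
        replace (2 * S * (1 + S) * (sin t ^ 2 * - / (2 * D ^ 2 * D)) - (D - (1 + S) * / D))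
          with ((- S * (1 + S) * sin t ^ 2 - D ^ 2 * D ^ 2 + (1 + S) * D ^ 2) / D ^ 3)
          by (field; lra).
        rewrite H2, Hc; f_equal; ring.
    - intros t _; apply (@ex_derive_continuous R_AbsRing R_NormedModule).
      assert (H1 := Delta_gt0 S t HS);
      assert (H3 := one_plus_sin2_gt0 S t HS).
      unfold Delta in *; auto_derive; repeat split; auto; simpl in H1; lra. }
  assert (CJ : cont (fun t => (1 + S) * / Delta S t)) by auto with cont.
  rewrite RInt_Rminus in E by (apply ex_RInt_cont; auto with cont).
  rewrite RInt_Rscal in E by (apply ex_RInt_cont; auto with cont).
  rewrite RInt_Rminus in E by (apply ex_RInt_cont; auto with cont).
  rewrite RInt_Rscal in E by (apply ex_RInt_cont; auto with cont).
  unfold ellE, ellK.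
  replace (2 * S * (1 + S) * (2 / PI * RInt I 0 (PI / 2)))
    with (2 / PI * (2 * S * (1 + S) * RInt I 0 (PI / 2))) by ring.
  replace (2 * S * (1 + S) * RInt I 0 (PI / 2)) with
   (RInt (Delta S) 0 (PI / 2) - (1 + S) * RInt (fun t => / Delta S t) 0 (PI / 2)) by lra.
  ring.
Qed.

(* The conical function [P_(-1/2)(cosh (2 q))] and its companion; the equations
   of [ellK] and [ellE] turn into [(sinh (2 q) conical')' = - sinh (2 q) conical]. *)
Definition conical (q : R) : R := ellK (sinh q ^ 2).
Definition conicalE (q : R) : R := ellE (sinh q ^ 2).

Lemma sinh2_gt (q : R) : -1 < sinh q ^ 2.
Proof. generalize (pow2_ge_0 (sinh q)); lra. Qed.

Lemma conical_gt0 (q : R) : 0 < conical q.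
Proof. apply ellK_gt0, sinh2_gt. Qed.

Lemma conical_0 : conical 0 = 1.
Proof. unfold conical; rewrite sinh_0; replace (0 ^ 2) with 0 by ring; apply ellK_0. Qed.

Lemma conicalE_0 : conicalE 0 = 1.
Proof. unfold conicalE; rewrite sinh_0; replace (0 ^ 2) with 0 by ring; apply ellE_0. Qed.

Lemma is_derive_sinh2 (q : R) : is_derive (fun q => sinh q ^ 2) q (2 * sinh q * cosh q).
Proof. auto_derive; auto; simpl; ring. Qed.

(** Equal to [- sinh (2 q) h'] for [h = conical]; written with [conicalE], it can be differentiated
    at 0 as well. *)
Definition Phi (q : R) : R := 2 * (cosh q ^ 2 * conical q - conicalE q).

Lemma Phi_0 : Phi 0 = 0.
Proof. unfold Phi; rewrite conical_0, conicalE_0, cosh_0; ring. Qed.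

(** The third equation identifies [Phi]; the fourth says that [Phi' = sinh (2 q) h]. Together they
    are Legendre's equation of degree -1/2 in the variable [cosh (2 q)]. *)
Lemma conical_derive_system (q : R) : exists dh de,
  is_derive conical q dh /\ is_derive conicalE q de /\
  sinh (2 * q) * dh = - Phi q /\
  2 * (sinh (2 * q) * conical q + cosh q ^ 2 * dh - de) = sinh (2 * q) * conical q.
Proof.
assert (HS := sinh2_gt q).
destruct (ellK_derive _ HS) as [dK [K1 K2]].
destruct (ellE_derive _ HS) as [dE [E1 E2]].
assert (D := is_derive_sinh2 q); assert (C := cosh2_sinh2 q).
exists (2 * sinh q * cosh q * dK), (2 * sinh q * cosh q * dE).
split; [|split; [|split]].
- now apply (is_derive_comp ellK (fun q => sinh q ^ 2)).
- now apply (is_derive_comp ellE (fun q => sinh q ^ 2)).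
- unfold Phi, conical, conicalE; rewrite sinh_2x, C.
  replace (2 * (sinh q * cosh q) * (2 * sinh q * cosh q * dK)) with
   (2 * (2 * sinh q ^ 2 * (cosh q ^ 2) * dK)) by ring.
  rewrite C, K2; ring.
- rewrite sinh_2x; fold (conical q) in K2, E2; fold (conicalE q) in K2, E2; rewrite C.
  (* The elliptic equations carry the factor [sinh q ^ 2], of which one power must be cancelled;
     where it is zero both sides vanish. *)
  destruct (Req_dec (sinh q) 0) as [->|Hs]; [ring|].
  set (s := sinh q) in *; set (c := cosh q) in *; clearbody s c.
  assert (X : 2 * s * (conical q + (1 + s ^ 2) * dK - dE) = s * conical q).
  { apply Rmult_eq_reg_l with s; auto.
    replace (s * (2 * s * (conical q + (1 + s ^ 2) * dK - dE))) with
      (2 * s ^ 2 * conical q + 2 * s ^ 2 * (1 + s ^ 2) * dK - 2 * s ^ 2 * dE) by ring.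
    rewrite K2, E2; ring. }
  replace (2 * (2 * (s * c) * conical q + (1 + s ^ 2) * (2 * s * c * dK) - 2 * s * c * dE))
    with (2 * c * (2 * s * (conical q + (1 + s ^ 2) * dK - dE))) by ring.
  rewrite X; ring.
Qed.

Lemma conical_cont : cont conical.
Proof.
intros q; destruct (conical_derive_system q) as [dh [de [H _]]].
apply (@ex_derive_continuous R_AbsRing R_NormedModule); now exists dh.
Qed.
#[global] Hint Resolve conical_cont : cont.

Lemma conical_derive (q : R) : q <> 0 -> is_derive conical q (- Phi q / sinh (2 * q)).
Proof.
intros Hq; destruct (conical_derive_system q) as [dh [de [H1 [H2 [H3 H4]]]]].
assert (sinh (2 * q) <> 0) by (apply sinh_neq0; lra).
assert (E : - Phi q / sinh (2 * q) = dh) by (rewrite <- H3; field; auto).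
now rewrite E.
Qed.

Lemma Phi_derive (q : R) : is_derive Phi q (sinh (2 * q) * conical q).
Proof.
destruct (conical_derive_system q) as [dh [de [H1 [H2 [H3 H4]]]]].
rewrite <- H4; unfold Phi.
auto_derive; [repeat split; eexists; eauto|].
change (fun x => conical x) with conical; change (fun x => conicalE x) with conicalE.
rewrite (is_derive_unique _ _ _ H1), (is_derive_unique _ _ _ H2), sinh_2x; simpl; ring.
Qed.

Lemma sinh2x_conical_cont : cont (fun r => sinh (2 * r) * conical r).
Proof.
assert (cont (fun r => sinh (2 * r))) by
  (apply (cont_comp (fun r => 2 * r) sinh); auto with cont).
auto with cont.
Qed.

Lemma Phi_RInt (q : R) : Phi q = q * RInt (fun u => sinh (2 * (u * q)) * conical (u * q)) 0 1.
Proof.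
rewrite (RInt_dilate (fun r => sinh (2 * r) * conical r) q) by apply sinh2x_conical_cont.
symmetry; rewrite (is_RInt_unique _ 0 q (Phi q - Phi 0)).
- rewrite Phi_0; ring.
- apply (is_RInt_derive (V:=R_CompleteNormedModule) Phi).
  + intros x _; apply Phi_derive.
  + intros x _; apply sinh2x_conical_cont.
Qed.

(** Alternation concerns every real [q], so both directions are needed; the exceptional point 0 is
    always an endpoint. *)
Lemma RInt_ftc_punctured (F f : R -> R) (q : R) : cont f -> cont F ->
  (forall x, x <> 0 -> is_derive F x (f x)) -> RInt f 0 q = F q - F 0.
Proof.
intros Hf HF HD; destruct (Rle_lt_dec 0 q) as [Hq|Hq].
- apply RInt_ftc_open; auto; intros x Hx; apply HD; lra.
- assert (E : RInt f q 0 = F 0 - F q).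
  { apply RInt_ftc_open; auto; try lra; intros x Hx; apply HD; lra. }
  rewrite <- (opp_RInt_swap (V:=R_CompleteNormedModule)) by now apply ex_RInt_cont.
  rewrite E; unfold opp; simpl; ring.
Qed.

Lemma locally_neq0 (q : R) : q <> 0 -> locally q (fun x => x <> 0).
Proof. intros Hq; now apply (open_neq 0). Qed.

Lemma cont_removable (f num den : R -> R) :
  continuous f 0 -> cont num -> cont den ->
  (forall q, q <> 0 -> den q <> 0) -> (forall q, q <> 0 -> f q = num q / den q) ->
  cont f.
Proof.
intros H0 Hn Hd Hd0 E q; destruct (Req_dec q 0) as [->|Hq]; auto.
apply (continuous_ext_loc _ (fun q => num q / den q)).
- eapply filter_imp; [|now apply (locally_neq0 q)].
  intros x Hx; symmetry; now apply E.
- apply (continuous_mult num (fun q => / den q)); auto.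
  apply continuous_comp; auto; apply continuous_Rinv; auto.
Qed.

(** * The conical function is alternating *)

Lemma conical_le1 (q : R) : conical q <= 1.
Proof.
assert (HS := sinh2_gt q); assert (HP := PI_RGT_0).
unfold conical, ellK; rewrite <- (RInt_2_PI 1).
apply Rmult_le_compat_l.
- apply Rlt_le, Rdiv_lt_0_compat; lra.
- apply RInt_le; [lra|now apply ex_RInt_cont, Delta_inv_cont|apply ex_RInt_cont; auto with cont|].
  intros t _; rewrite <- Rinv_1; apply Rinv_le_contravar; [lra|].
  unfold Delta; rewrite <- sqrt_1 at 1; apply sqrt_le_1_alt.
  generalize (pow2_ge_0 (sinh q)) (pow2_ge_0 (sin t)); nra.
Qed.

(** This is [- h'(q)/q] (see [slope_Phi]), written as a mixture of products of alternating
    functions: the formula of [Phi_RInt] divided by [q sinh (2 q)]. *)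
Definition slope (q : R) : R := RInt (fun u => sinh_ratio (2 * q) u * conical (u * q)) 0 1.

Lemma conical_dilate_cont (q : R) : cont (fun u => conical (u * q)).
Proof. apply (cont_comp (fun u => u * q) conical); auto with cont. Qed.
#[global] Hint Resolve conical_dilate_cont : cont.

Lemma slope_ge0 (q : R) : 0 <= slope q.
Proof.
apply RInt_ge_0; [lra|apply ex_RInt_cont; auto with cont|].
intros u Hu; apply Rmult_le_pos; apply Rlt_le; [now apply sinh_ratio_gt0|apply conical_gt0].
Qed.

Lemma slope_le1 (q : R) : slope q <= 1.
Proof.
replace 1 with (RInt (fun _ => 1) 0 1) by
  (rewrite (RInt_const (V:=R_CompleteNormedModule)); unfold scal; simpl; unfold mult; simpl; ring).
apply RInt_le; [lra|apply ex_RInt_cont; auto with cont|apply ex_RInt_cont; auto with cont|].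
intros u Hu.
assert (HK := alt_sinh_ratio 1 u Hu 1%nat ltac:(lia) (2 * q)); simpl in HK.
generalize (sinh_ratio_gt0 (2 * q) u Hu) (conical_gt0 (u * q)) (conical_le1 (u * q)); nra.
Qed.

Lemma slope_Phi (q : R) : q <> 0 -> slope q = Phi q / (q * sinh (2 * q)).
Proof.
intros Hq; assert (Hs : sinh (2 * q) <> 0) by (apply sinh_neq0; lra).
rewrite Phi_RInt.
rewrite (RInt_eq (fun u => sinh (2 * (u * q)) * conical (u * q))
  (fun u => sinh (2 * q) * (sinh_ratio (2 * q) u * conical (u * q)))).
- rewrite RInt_Rscal by (apply ex_RInt_cont; auto with cont).
  fold (slope q); field; auto.
- intros u; unfold sinh_ratio; destruct (Req_EM_T (2 * q) 0); [lra|].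
  replace (u * (2 * q)) with (2 * (u * q)) by ring; field; auto.
Qed.

Lemma Phi_cont : cont Phi.
Proof. apply (cont_of_derive _ _ Phi_derive). Qed.

Lemma sinh2x_cont : cont (fun q => sinh (2 * q)).
Proof. apply (cont_comp (fun q => 2 * q) sinh); auto with cont. Qed.
#[global] Hint Resolve Phi_cont sinh2x_cont : cont.

(** This is [- h']. Continuity of [slope] at 0 is a consequence of [alt_conical], whose proof needs
    an integral of [slope] first. The factor [q] breaks the circle: [0 <= slope <= 1] makes [decay]
    continuous at 0. *)
Definition decay (q : R) : R := q * slope q.

Lemma decay_cont : cont decay.
Proof.
apply (cont_removable decay Phi (fun q => sinh (2 * q))); auto with cont.
- apply (filterlim_locally decay); intros eps; exists eps; intros x Hx.
  unfold ball in *; simpl in *; unfold AbsRing_ball, abs, minus, plus, opp in *; simpl in *.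
  unfold decay; rewrite Rmult_0_l, Ropp_0, Rplus_0_r in *.
  rewrite Rabs_mult, (Rabs_pos_eq (slope x)) by apply slope_ge0.
  generalize (Rabs_pos x) (slope_ge0 x) (slope_le1 x); nra.
- intros q Hq; apply sinh_neq0; lra.
- intros q Hq; unfold decay; rewrite slope_Phi by auto; field.
  split; [apply sinh_neq0; lra|auto].
Qed.
#[global] Hint Resolve decay_cont : cont.

Lemma decay_derive (q : R) : q <> 0 -> is_derive conical q (- decay q).
Proof.
intros Hq; replace (- decay q) with (- Phi q / sinh (2 * q)); [now apply conical_derive|].
unfold decay; rewrite slope_Phi by auto; unfold Rdiv; field.
split; [apply sinh_neq0; lra|auto].
Qed.

Lemma mul_slope_cont (q : R) : cont (fun u => u * slope (u * q)).
Proof.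
destruct (Req_dec q 0) as [->|Hq].
- apply (cont_ext (fun u => u * slope 0)); auto with cont.
  intros u; now rewrite Rmult_0_r.
- apply (cont_ext (fun u => / q * decay (u * q))).
  + intros u; unfold decay; field; auto.
  + apply cont_mult; auto with cont.
    apply (cont_comp (fun u => u * q) decay); auto with cont.
Qed.

Lemma conical_slope (q : R) : conical q = 1 - q ^ 2 * RInt (fun u => u * slope (u * q)) 0 1.
Proof.
assert (E : @eq R (RInt decay 0 q) (1 - conical q)).
{ rewrite (RInt_ftc_punctured (fun q => - conical q)); auto with cont.
  - rewrite conical_0; ring.
  - apply (cont_ext (fun q => 0 - conical q)); auto with cont; intros; ring.
  - intros x Hx; rewrite <- (Ropp_involutive (decay x)).
    apply (is_derive_opp (K:=R_AbsRing) (V:=R_NormedModule) conical); now apply decay_derive. }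
rewrite <- (RInt_dilate decay q) in E by auto with cont.
rewrite (RInt_eq _ (fun u => q * (u * slope (u * q)))) in E by (intros u; unfold decay; ring).
rewrite RInt_Rscal in E by apply ex_RInt_cont, mul_slope_cont.
simpl; lra.
Qed.

Definition slope_coef (a : nat -> R) (i : nat) : R :=
  RInt (fun u => sum_f_R0 (fun k => (2 ^ 2) ^ k * sinh_ratio_coef k u *
    ((u ^ 2) ^ (i - k) * a (i - k)%nat)) i) 0 1.

Lemma alt_slope (J : nat) (a : nat -> R) : alt J a conical -> alt J (slope_coef a) slope.
Proof.
intros Ha.
apply (alt_mix J (fun u i => sum_f_R0 (fun k => (2 ^ 2) ^ k * sinh_ratio_coef k u *
    ((u ^ 2) ^ (i - k) * a (i - k)%nat)) i) (fun u q => sinh_ratio (2 * q) u * conical (u * q))).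
- intros u Hu.
  apply (alt_mul J (fun k => (2 ^ 2) ^ k * sinh_ratio_coef k u) (fun k => (u ^ 2) ^ k * a k)
    (fun q => sinh_ratio (2 * q) u) (fun q => conical (u * q))).
  + now apply (alt_dilate J 2 (fun i => sinh_ratio_coef i u) (fun q => sinh_ratio q u)), alt_sinh_ratio.
  + now apply alt_dilate.
- intros q; apply ex_RInt_cont; auto with cont.
- intros i; apply ex_RInt_cont.
  apply (cont_sum (fun k u => (2 ^ 2) ^ k * sinh_ratio_coef k u * ((u ^ 2) ^ (i - k) * a (i - k)%nat))).
  intros k; auto 9 with cont.
Qed.

Lemma alt_mul_slope (J : nat) (a : nat -> R) : alt J a slope ->
  alt J (fun i => RInt (fun u => u * ((u ^ 2) ^ i * a i)) 0 1)
    (fun q => RInt (fun u => u * slope (u * q)) 0 1).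
Proof.
intros Ha.
apply (alt_mix J (fun u i => u * ((u ^ 2) ^ i * a i)) (fun u q => u * slope (u * q))).
- intros u Hu; apply alt_scal; [lra|now apply alt_dilate].
- intros q; apply ex_RInt_cont, mul_slope_cont.
- intros i; apply ex_RInt_cont; auto 9 with cont.
Qed.

(* By [conical_slope], each pass through [alt_slope] gains one order. *)
Lemma alt_conical (J : nat) : exists a, alt J a conical.
Proof.
induction J as [|J [a IH]].
(* Order 0 is mere positivity, so any coefficients serve. *)
- exists (fun _ => 1); intros j Hj q; replace j with 0%nat by lia.
  apply Rlt_le, conical_gt0.
- exists (fun i => match i with O => 1 | S i =>
    RInt (fun u => u * ((u ^ 2) ^ i * slope_coef a i)) 0 1 end).
  apply (alt_of_factor J _ conical (fun q => RInt (fun u => u * slope (u * q)) 0 1)).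
  + apply conical_slope.
  + intros q; apply Rlt_le, conical_gt0.
  + now apply alt_mul_slope, alt_slope.
Qed.

Lemma alt_conical1 (J : nat) : exists a, a O = 1 /\ alt J a conical.
Proof.
destruct (alt_conical (S (S J))) as [a Ha]; exists a; split.
- rewrite <- (alt_at0 J a conical Ha); apply conical_0.
- apply (alt_le _ (S (S J))); auto.
Qed.

Lemma slope_cont : cont slope.
Proof.
destruct (alt_conical 2) as [a Ha].
apply (cont_removable slope Phi (fun q => q * sinh (2 * q))); auto with cont.
- now apply (alt_continuous0 0 (slope_coef a)), alt_slope.
- intros q Hq; apply Rmult_integral_contrapositive; split; auto; apply sinh_neq0; lra.
- apply slope_Phi.
Qed.

Lemma qcsch_cont : cont qcsch.
Proof.
apply (cont_removable qcsch (fun q => q) sinh); auto with cont.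
- apply (alt_continuous0 0 qcschc), alt_qcsch.
- apply sinh_neq0.
- intros q Hq; unfold qcsch; destruct (Req_EM_T q 0); lra.
Qed.
#[global] Hint Resolve slope_cont qcsch_cont : cont.

Lemma qcsch_neq0 (q : R) : q <> 0 -> qcsch q = q / sinh q.
Proof. intros Hq; unfold qcsch; destruct (Req_EM_T q 0); lra. Qed.

(** * The odd and even parts of the Laplace kernel *)

(** The coefficients stay anonymous: only signs matter, and the expansion is identified at the end
    by uniqueness. *)
Definition Alt (J : nat) (f : R -> R) : Prop := exists a, alt J a f.

Lemma Alt_plus (J : nat) (f g : R -> R) :
  Alt J f -> Alt J g -> Alt J (fun q => f q + g q).
Proof. intros [a Ha] [b Hb]; eexists; now apply alt_plus; eassumption. Qed.

Lemma Alt_mul (J : nat) (f g : R -> R) :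
  Alt J f -> Alt J g -> Alt J (fun q => f q * g q).
Proof. intros [a Ha] [b Hb]; eexists; now apply alt_mul; eassumption. Qed.

Lemma Alt_shift (J : nat) (f : R -> R) : (2 <= J)%nat -> cont f -> f 0 = 1 -> Alt (S J) f ->
  exists g, cont g /\ (forall q, f q = 1 - q ^ 2 * g q) /\ Alt J g.
Proof.
intros HJ Hf H0 [a Ha]; destruct J as [|[|J]]; try lia.
assert (Hs := alt_shift _ a f Ha).
assert (E0 : a O = 1) by (rewrite <- (alt_at0 _ a f Ha); auto).
assert (E := fun q => shiftE _ a f q Ha); rewrite E0 in E.
exists (shift a f); split; [|split; auto; eexists; eauto].
apply (cont_removable _ (fun q => 1 - f q) (fun q => q ^ 2)); auto with cont.
- eapply alt_continuous0; eauto.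
- intros q Hq; now apply pow_nonzero.
- intros q Hq; rewrite (E q); field; auto.
Qed.

(** Half-angle formula: [1 + cosh q = 2 cosh (q/2)^2]. *)
Lemma Alt_inv_1_cosh (J : nat) : Alt J (fun q => / (1 + cosh q)).
Proof.
destruct (Alt_mul J (fun q => / cosh (1 / 2 * q)) (fun q => / cosh (1 / 2 * q))) as [a Ha].
1, 2: eexists; apply (alt_dilate J (1 / 2) sechc (fun q => / cosh q)), alt_sech.
exists (fun i => 1 / 2 * a i).
apply (alt_ext J _ (fun q => 1 / 2 * (/ cosh (1 / 2 * q) * / cosh (1 / 2 * q)))).
- intros q; assert (H := cosh_gt0 (1 / 2 * q)).
  replace (cosh q) with (2 * cosh (1 / 2 * q) ^ 2 - 1).
  + revert H; generalize (cosh (1 / 2 * q)); intros c H.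
    replace (1 + (2 * c ^ 2 - 1)) with (2 * c ^ 2) by ring; field; lra.
  + rewrite cosh2_sinh2; replace q with (2 * (1 / 2 * q)) at 2 by field.
    rewrite cosh_2x; ring.
- apply alt_scal; auto; lra.
Qed.

(** Equal to [- h'/sinh q] away from 0. *)
Definition csch_slope (q : R) : R := qcsch q * slope q.

Lemma csch_slope_cont : cont csch_slope.
Proof. unfold csch_slope; auto with cont. Qed.
#[global] Hint Resolve csch_slope_cont : cont.

Definition avg_csch_slope (q : R) : R := RInt (fun u => csch_slope (u * q)) 0 1.

Lemma csch_slope_dilate_cont (q : R) : cont (fun u => csch_slope (u * q)).
Proof. apply (cont_comp (fun u => u * q) csch_slope); auto with cont. Qed.

Lemma Alt_avg_csch_slope (J : nat) : Alt J avg_csch_slope.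
Proof.
destruct (alt_conical J) as [a Ha].
destruct (Alt_mul J qcsch slope) as [c Hc].
{ exists qcschc; apply alt_qcsch. }
{ exists (slope_coef a); now apply alt_slope. }
exists (fun i => RInt (fun u => (u ^ 2) ^ i * c i) 0 1).
apply (alt_mix J (fun u i => (u ^ 2) ^ i * c i) (fun u q => csch_slope (u * q))).
- intros u _; now apply (alt_dilate J u c csch_slope).
- intros q; apply ex_RInt_cont, csch_slope_dilate_cont.
- intros i; apply ex_RInt_cont; auto with cont.
Qed.

(** By Legendre's equation [sinh q h + cosh q h'] has derivative [- h'/sinh q]. A difference whose
    sign is unclear is thereby [q] times an average of alternating functions. *)
Lemma avg_csch_slope_E (q : R) : q <> 0 -> avg_csch_slope q = (sinh q * conical q - Phi q / (2 * sinh q)) / q.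
Proof.
intros Hq.
assert (Hs : forall x, x <> 0 -> sinh x <> 0) by apply sinh_neq0.
assert (E : @eq R (RInt csch_slope 0 q) (sinh q * conical q - cosh q * (q * slope q))).
{ rewrite (RInt_ftc_punctured (fun q => sinh q * conical q - cosh q * (q * slope q))); auto 9 with cont.
  - rewrite sinh_0; ring.
  - intros x Hx; assert (Hsx := Hs x Hx); assert (Hcx := cosh_gt0 x).
    (* The form with [slope] is continuous at 0; the form with [Phi] can be differentiated away from
       0. *)
    apply (is_derive_ext_loc (fun q => sinh q * conical q - Phi q / (2 * sinh q))).
    + eapply filter_imp; [|now apply (locally_neq0 x)].
      intros t Ht; rewrite slope_Phi, sinh_2x by auto; simpl; field.
      repeat split; auto; generalize (cosh_gt0 t); lra.
    + assert (Dh := conical_derive x Hx); assert (DP := Phi_derive x).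
      auto_derive; [repeat split; try (eexists; eassumption); lra|].
      change (fun x => conical x) with conical; change (fun x => Phi x) with Phi.
      rewrite (is_derive_unique _ _ _ Dh), (is_derive_unique _ _ _ DP).
      unfold csch_slope; rewrite qcsch_neq0, slope_Phi, !sinh_2x by auto.
      assert (Hc2 := cosh2_sinh2 x).
      field [Hc2]; lra. }
rewrite <- (RInt_dilate csch_slope q) in E by auto with cont; fold (avg_csch_slope q) in E.
apply Rmult_eq_reg_l with q; auto; rewrite E, slope_Phi, sinh_2x by auto.
field; repeat split; auto; generalize (cosh_gt0 q); lra.
Qed.

Definition sech_conical (q : R) : R := / cosh q * conical q.

Lemma sech_conical_cont : cont sech_conical.
Proof.
apply cont_mult; auto with cont.
apply (cont_ext (fun q => 1 / cosh q)); [intros; field|apply cont_div; auto with cont];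
  intros; generalize (cosh_gt0 x); lra.
Qed.

(** Strictness comes from the factor [/ cosh q], the remainders of [conical] being known only to be
    nonnegative. It is the source of the strict inequality in the theorem. *)
Lemma alt_sech_conical (J : nat) : exists a, alt J a sech_conical /\
  forall j, (j <= J)%nat -> forall q, q <> 0 -> 0 < rem a sech_conical j q.
Proof.
destruct (alt_conical J) as [b Hb]; assert (Hs := alt_sech J).
eexists; split; [apply (alt_mul J sechc b); auto|].
intros j Hj q Hq; eapply Rlt_le_trans; [|eapply (rem_mul_ge J sechc b); eauto].
apply Rmult_lt_0_compat; [now apply rem_sech_gt0|apply conical_gt0].
Qed.

(* The odd part of the Laplace kernel of the error; [- sech_conical] is the even part. *)
Definition csch_defect (q : R) : R := if Req_EM_T q 0 then 0 else / q - conical q / sinh q.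

Lemma csch_defect_Alt (J : nat) : (2 <= J)%nat ->
  exists g, cont g /\ (forall q, csch_defect q = q * g q) /\ Alt J g.
Proof.
intros HJ.
destruct (Alt_shift J (fun q => qcsch q * conical q)) as [g [G1 [G2 G3]]]; auto with cont.
- unfold qcsch; destruct (Req_EM_T 0 0); rewrite ?conical_0; lra.
- apply Alt_mul; [eexists; apply alt_qcsch|apply alt_conical].
- exists g; repeat split; auto; intros q; unfold csch_defect; destruct (Req_EM_T q 0) as [->|Hq]; [ring|].
  specialize (G2 q); rewrite qcsch_neq0 in G2 by auto.
  assert (Hs := sinh_neq0 q Hq).
  replace (conical q / sinh q) with ((q / sinh q * conical q) / q) by (field; auto).
  rewrite G2; field; auto.
Qed.

Lemma csch_defect_cont : cont csch_defect.
Proof.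
destruct (csch_defect_Alt 2 ltac:(lia)) as [g [G1 [G2 _]]].
apply (cont_ext (fun q => q * g q)); auto with cont.
Qed.

Lemma csch_defect_derive (q : R) : q <> 0 ->
  is_derive csch_defect q (- / q ^ 2 + conical q * cosh q / sinh q ^ 2 + Phi q / (2 * sinh q ^ 2 * cosh q)).
Proof.
intros Hq; assert (Hs := sinh_neq0 q Hq); assert (Hc := cosh_gt0 q).
apply (is_derive_ext_loc (fun q => / q - conical q / sinh q)).
- eapply filter_imp; [|now apply (locally_neq0 q)].
  intros t Ht; unfold csch_defect; destruct (Req_EM_T t 0); [contradiction|reflexivity].
- assert (Dh := conical_derive q Hq).
  auto_derive; [repeat split; try (eexists; eassumption); auto|].
  change (fun x => conical x) with conical.
  rewrite (is_derive_unique _ _ _ Dh), sinh_2x; field; lra.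
Qed.

(* [E] absorbs all that is left of [4 sech_conical - csch_defect'] once
   [2 sech_conical] is set aside; its five summands below are manifestly alternating. *)
Lemma csch_defect_derive_alt (J : nat) : (2 <= J)%nat -> exists E, cont E /\ Alt J E /\
  forall q, q <> 0 -> is_derive csch_defect q (2 * sech_conical q - E q).
Proof.
intros HJ.
assert (Ah : Alt (S J) conical) by apply alt_conical.
assert (Az : Alt (S J) qcsch) by (eexists; apply alt_qcsch).
destruct (Alt_shift J conical) as [g1 [C1 [E1 A1]]]; auto using conical_0 with cont.
destruct (Alt_shift J (fun q => qcsch q * qcsch q)) as [g2 [C2 [E2 A2]]]; auto with cont.
{ unfold qcsch; destruct (Req_EM_T 0 0); lra. }
{ now apply Alt_mul. }
(* The last two summands give [1/q^2 - h/sinh^2 q], which takes care of the double pole of [w']. The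
   one with [avg_csch_slope] is [h/cosh q - Phi/(2 sinh^2 q cosh q)], and the first is
   [h/sinh^2 q - h/(cosh q sinh^2 q)]. *)
assert (A : Alt J (fun q => sech_conical q * / (1 + cosh q) + qcsch q * / cosh q * avg_csch_slope q +
   conical q * g2 q + g1 q)).
{ assert (Ac : Alt J (fun q => / cosh q)) by (eexists; apply alt_sech).
  assert (Ah' : Alt J conical) by apply alt_conical.
  assert (Az' : Alt J qcsch) by (eexists; apply alt_qcsch).
  apply Alt_plus; [apply Alt_plus; [apply Alt_plus|]|exact A1].
  - apply (Alt_mul J sech_conical); [now apply (Alt_mul J (fun q => / cosh q))|apply Alt_inv_1_cosh].
  - apply (Alt_mul J (fun q => qcsch q * / cosh q) avg_csch_slope); [|apply Alt_avg_csch_slope].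
    now apply (Alt_mul J qcsch).
  - now apply Alt_mul. }
assert (EA : forall q, q <> 0 -> sech_conical q * / (1 + cosh q) + qcsch q * / cosh q * avg_csch_slope q +
   conical q * g2 q + g1 q =
   2 * sech_conical q - (- / q ^ 2 + conical q * cosh q / sinh q ^ 2 + Phi q / (2 * sinh q ^ 2 * cosh q))).
{ intros q Hq; assert (Hs := sinh_neq0 q Hq); assert (Hc := cosh_gt0 q).
  assert (Hc2 := cosh2_sinh2 q).
  specialize (E1 q); specialize (E2 q); rewrite qcsch_neq0 in E2 by auto.
  rewrite qcsch_neq0, avg_csch_slope_E by auto; unfold sech_conical.
  replace (g1 q) with ((1 - conical q) / q ^ 2) by (rewrite E1; field; auto).
  replace (g2 q) with ((1 - q / sinh q * (q / sinh q)) / q ^ 2) by (rewrite E2; field; auto).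
  replace (/ (1 + cosh q)) with ((cosh q - 1) / sinh q ^ 2).
  - field [Hc2]; lra.
  - replace (sinh q ^ 2) with ((cosh q - 1) * (1 + cosh q)) by lra.
    field; split; [lra|].
    intros X; apply Hs; assert (sinh q ^ 2 = 0) by nra; nra. }
eexists; split; [|split; [exact A|]].
- destruct J as [|[|J]]; try lia; destruct A as [a Ha].
  (* The numerator is the right side of [EA] multiplied by [q^2 sinh^2 q cosh q]. *)
  apply (cont_removable _ (fun q => 2 * conical q * q ^ 2 * sinh q ^ 2 + cosh q * sinh q ^ 2
     - conical q * cosh q ^ 2 * q ^ 2 - Phi q / 2 * q ^ 2) (fun q => q ^ 2 * (sinh q ^ 2 * cosh q))).
  + eapply alt_continuous0; eauto.
  + unfold Rdiv; auto 10 with cont.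
  + auto 10 with cont.
  + intros q Hq; assert (Hs := sinh_neq0 q Hq); assert (Hc := cosh_gt0 q).
    apply Rmult_integral_contrapositive; split; [now apply pow_nonzero|].
    apply Rmult_integral_contrapositive; split; [now apply pow_nonzero|lra].
  + intros q Hq; assert (Hs := sinh_neq0 q Hq); assert (Hc := cosh_gt0 q).
    cbv beta; rewrite EA by auto; unfold sech_conical; field; lra.
- intros q Hq; cbv beta; rewrite EA by auto.
  evar_last; [now apply csch_defect_derive|simpl; ring].
Qed.

(** * Laplace transforms *)

(** Integer upper bounds suffice: existence is shown by monotone convergence, and the identities
    hold at each finite bound up to a vanishing boundary term. *)
Definition Lap (lam : R) (f : R -> R) (I : R) : Prop :=
  is_lim_seq (fun n => RInt (fun q => exp (- lam * q) * f q) 0 (INR n)) I.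

Lemma expl_cont (lam : R) : cont (fun q => exp (lam * q)).
Proof. apply (cont_comp (fun q => lam * q) exp); auto with cont. Qed.
#[global] Hint Resolve expl_cont : cont.

Lemma Lap_unique (lam : R) (f : R -> R) (I I' : R) : Lap lam f I -> Lap lam f I' -> I = I'.
Proof.
intros H H'; apply is_lim_seq_unique in H; apply is_lim_seq_unique in H'.
rewrite H in H'; now injection H'.
Qed.

Lemma Lap_ext (lam : R) (f g : R -> R) (I : R) :
  (forall q, 0 < q -> f q = g q) -> Lap lam f I -> Lap lam g I.
Proof.
intros E; apply is_lim_seq_ext; intros n.
apply RInt_Rext; [apply pos_INR|]; intros x Hx; rewrite E; lra.
Qed.

Lemma Lap_plus (lam : R) (f g : R -> R) (I I' : R) : cont f -> cont g ->
  Lap lam f I -> Lap lam g I' -> Lap lam (fun q => f q + g q) (I + I').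
Proof.
intros Hf Hg H H'.
apply (is_lim_seq_ext (fun n => RInt (fun q => exp (- lam * q) * f q) 0 (INR n) +
   RInt (fun q => exp (- lam * q) * g q) 0 (INR n))).
- intros n; rewrite <- RInt_Rplus by (apply ex_RInt_cont; auto with cont).
  apply RInt_eq; intros; ring.
- now apply is_lim_seq_plus'.
Qed.

Lemma Lap_scal (lam l : R) (f : R -> R) (I : R) : cont f ->
  Lap lam f I -> Lap lam (fun q => l * f q) (l * I).
Proof.
intros Hf H.
apply (is_lim_seq_ext (fun n => l * RInt (fun q => exp (- lam * q) * f q) 0 (INR n))).
- intros n; rewrite <- RInt_Rscal by (apply ex_RInt_cont; auto with cont).
  apply RInt_eq; intros; ring.
- now apply (is_lim_seq_scal_l _ l I).
Qed.

Lemma Lap_minus (lam : R) (f g : R -> R) (I I' : R) : cont f -> cont g ->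
  Lap lam f I -> Lap lam g I' -> Lap lam (fun q => f q - g q) (I - I').
Proof.
intros Hf Hg H H'.
apply (Lap_ext _ (fun q => f q + (-1) * g q)); [intros; ring|].
replace (I - I') with (I + (-1) * I') by ring.
apply Lap_plus; auto with cont; now apply Lap_scal.
Qed.

Lemma Lap_shift (lam mu : R) (f : R -> R) (I : R) :
  Lap (lam + mu) f I -> Lap lam (fun q => exp (- mu * q) * f q) I.
Proof.
apply is_lim_seq_ext; intros n; apply RInt_eq; intros q.
replace (- (lam + mu) * q) with (- lam * q + - mu * q) by ring.
rewrite exp_plus; ring.
Qed.

Lemma RInt_mono_nat (f : R -> R) (m n : nat) : cont f -> (forall q, 0 < q -> 0 <= f q) ->
  (m <= n)%nat -> RInt f 0 (INR m) <= RInt f 0 (INR n).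
Proof.
intros Hf Hp Hmn; rewrite <- (RInt_Rchasles f 0 (INR m) (INR n)) by auto.
assert (0 <= RInt f (INR m) (INR n)); [|lra].
apply RInt_ge_0; [now apply le_INR|now apply ex_RInt_cont|].
intros q Hq; apply Hp; generalize (pos_INR m); lra.
Qed.

Lemma exp_mul_ge0 (lam : R) (f : R -> R) (q : R) : 0 <= f q -> 0 <= exp (- lam * q) * f q.
Proof. intros H; apply Rmult_le_pos; auto; apply Rlt_le, exp_pos. Qed.

Lemma Lap_ge_partial (lam : R) (f : R -> R) (I : R) (m : nat) : cont f ->
  (forall q, 0 < q -> 0 <= f q) -> Lap lam f I ->
  RInt (fun q => exp (- lam * q) * f q) 0 (INR m) <= I.
Proof.
intros Hf Hp HI.
apply (is_lim_seq_incr_compare _ I HI); intros n.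
apply RInt_mono_nat; auto with cont; intros q Hq; apply exp_mul_ge0; auto.
Qed.

Lemma Lap_ge0 (lam : R) (f : R -> R) (I : R) : cont f ->
  (forall q, 0 < q -> 0 <= f q) -> Lap lam f I -> 0 <= I.
Proof.
intros Hf Hp HI; generalize (Lap_ge_partial lam f I 0 Hf Hp HI); simpl.
now rewrite RInt_point.
Qed.

Lemma Lap_gt0 (lam : R) (f : R -> R) (I : R) : cont f ->
  (forall q, 0 < q -> 0 < f q) -> Lap lam f I -> 0 < I.
Proof.
intros Hf Hp HI.
eapply Rlt_le_trans; [|apply (Lap_ge_partial lam f I 1); auto; intros; now apply Rlt_le, Hp].
apply RInt_gt_0; simpl; [lra| |].
- intros q Hq; apply Rmult_lt_0_compat; [apply exp_pos|apply Hp; lra].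
- intros q _; apply cont_mult; auto with cont.
Qed.

Lemma Lap_ex_le (lam : R) (f g : R -> R) (G : R) : cont f -> cont g ->
  (forall q, 0 < q -> 0 <= f q <= g q) -> Lap lam g G -> exists I, Lap lam f I.
Proof.
intros Hf Hg Hp HG.
destruct (ex_finite_lim_seq_incr
  (fun n => RInt (fun q => exp (- lam * q) * f q) 0 (INR n)) G) as [I HI].
- intros n; apply RInt_mono_nat; auto with cont; intros q Hq; apply exp_mul_ge0; now apply Hp.
- intros n; eapply Rle_trans;
    [|apply (Lap_ge_partial lam g G n); auto; intros q Hq; specialize (Hp q Hq); lra].
  apply RInt_le; [apply pos_INR| | |]; try (apply ex_RInt_cont; auto with cont).
  intros q Hq; apply Rmult_le_compat_l; [apply Rlt_le, exp_pos|apply Hp; lra].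
- now exists I.
Qed.

Lemma Lap_le (lam : R) (f g : R -> R) (I G : R) : cont f -> cont g ->
  (forall q, 0 < q -> f q <= g q) -> Lap lam f I -> Lap lam g G -> I <= G.
Proof.
intros Hf Hg Hp HI HG.
assert (0 <= G - I); [|lra].
apply (Lap_ge0 lam (fun q => g q - f q)); auto with cont.
- intros q Hq; specialize (Hp q Hq); lra.
- now apply Lap_minus.
Qed.

Lemma Lap_ftc (lam : R) (F f : R -> R) (l : R) : cont f -> cont F ->
  (forall q, q <> 0 -> is_derive F q (exp (- lam * q) * f q)) ->
  is_lim_seq (fun n => F (INR n)) l -> Lap lam f (l - F 0).
Proof.
intros Hf HF HD Hl.
apply (is_lim_seq_ext (fun n => F (INR n) - F 0)).
- intros n; symmetry; apply RInt_ftc_punctured; auto with cont.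
- apply is_lim_seq_minus'; auto; apply is_lim_seq_const.
Qed.

Lemma exp_INR_mult (n : nat) (x : R) : exp (INR n * x) = exp x ^ n.
Proof.
induction n as [|n IH]; [simpl; now rewrite Rmult_0_l, exp_0|].
rewrite S_INR, Rmult_plus_distr_r, Rmult_1_l, exp_plus, IH; simpl; ring.
Qed.

Lemma lim_exp_pow (lam : R) (k : nat) : 0 < lam ->
  is_lim_seq (fun n => exp (- lam * INR n) * INR n ^ k) 0.
Proof.
intros Hl.
assert (Hk : 0 < INR (S k)) by (apply lt_0_INR; lia).
set (c := (lam / INR (S k)) ^ S k).
assert (Hc : 0 < c) by now apply pow_lt, Rdiv_lt_0_compat.
apply (is_lim_seq_le_le_loc (fun _ => 0) _ (fun n => / c * / INR n)).
- exists 1%nat; intros n Hn.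
  assert (Hn0 : 0 < INR n) by (apply lt_0_INR; lia).
  split; [apply Rmult_le_pos; [apply Rlt_le, exp_pos|apply pow_le; lra]|].
  (* From [exp x >= x] at [x = lam n / (k + 1)], raised to the power [k + 1]. *)
  assert (HE : c * INR n ^ S k <= exp (lam * INR n)).
  { replace (lam * INR n) with (INR (S k) * (lam / INR (S k) * INR n)) by (field; lra).
    unfold c; rewrite <- Rpow_mult_distr, exp_INR_mult.
    apply pow_incr; split.
    - apply Rmult_le_pos; [apply Rlt_le, Rdiv_lt_0_compat|]; lra.
    - generalize (exp_ineq1_le (lam / INR (S k) * INR n)); lra. }
  rewrite Ropp_mult_distr_l_reverse, exp_Ropp.
  assert (Hp : 0 < INR n ^ k) by now apply pow_lt.
  assert (He := exp_pos (lam * INR n)); simpl in HE.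
  apply Rmult_le_reg_l with (exp (lam * INR n) * (c * INR n));
    [apply Rmult_lt_0_compat; auto; now apply Rmult_lt_0_compat|].
  replace (exp (lam * INR n) * (c * INR n) * (/ exp (lam * INR n) * INR n ^ k))
    with (c * (INR n * INR n ^ k)) by (field; lra).
  replace (exp (lam * INR n) * (c * INR n) * (/ c * / INR n)) with (exp (lam * INR n))
    by (field; lra); auto.
- apply is_lim_seq_const.
- replace (Finite 0) with (Rbar_mult (/ c) (Rbar_inv p_infty)) by (simpl; f_equal; ring).
  apply is_lim_seq_scal_l, is_lim_seq_inv; [apply is_lim_seq_INR|discriminate].
Qed.

Lemma Lap_pow (lam : R) (k : nat) : 0 < lam ->
  Lap lam (fun q => q ^ k) (INR (fact k) / lam ^ S k).
Proof.
intros Hl; induction k as [|k IH].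
- replace (INR (fact 0) / lam ^ 1) with (0 - (- (/ lam * exp (- lam * 0)))).
  + apply (Lap_ftc lam (fun q => - (/ lam * exp (- lam * q)))).
    * simpl; auto with cont.
    * apply (cont_ext (fun q => - / lam * exp (- lam * q))); auto with cont; intros; ring.
    * intros q _; auto_derive; auto; simpl; field; lra.
    * apply (is_lim_seq_ext (fun n => - / lam * (exp (- lam * INR n) * INR n ^ 0))).
      -- intros n; simpl; ring.
      -- replace (Finite 0) with (Rbar_mult (- / lam) 0) by (simpl; f_equal; ring).
         now apply is_lim_seq_scal_l, lim_exp_pow.
  + rewrite Rmult_0_r, exp_0; simpl; field; lra.
(* Integration by parts: the boundary term [exp (- lam q) q^(k+1)] vanishes at both ends. *)
- assert (H : Lap lam (fun q => lam * q ^ S k - INR (S k) * q ^ k)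
      (0 - (- (exp (- lam * 0) * 0 ^ S k)))).
  { apply (Lap_ftc lam (fun q => - (exp (- lam * q) * q ^ S k))).
    - auto with cont.
    - apply (cont_ext (fun q => (-1) * (exp (- lam * q) * q ^ S k))); auto with cont; intros; ring.
    - intros q _; auto_derive; auto.
      replace (Init.Nat.pred (S k)) with k by auto; change (match k with O => 1 | S _ => INR k + 1 end) with (INR (S k)); cbn [pow]; ring.
    - apply (is_lim_seq_ext (fun n => (-1) * (exp (- lam * INR n) * INR n ^ S k))).
      + intros n; ring.
      + replace (Finite 0) with (Rbar_mult (-1) 0) by (simpl; f_equal; ring).
        now apply is_lim_seq_scal_l, lim_exp_pow. }
  assert (H2 : Lap lam (fun q => lam * q ^ S k) (INR (S k) * (INR (fact k) / lam ^ S k))).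
  { apply (Lap_ext _ (fun q => (lam * q ^ S k - INR (S k) * q ^ k) + INR (S k) * q ^ k)).
    - intros; ring.
    - replace (INR (S k) * (INR (fact k) / lam ^ S k)) with
        (0 - (- (exp (- lam * 0) * 0 ^ S k)) + INR (S k) * (INR (fact k) / lam ^ S k))
        by (simpl; ring).
      apply Lap_plus; auto with cont.
      apply Lap_scal; auto with cont. }
  apply (Lap_scal lam (/ lam)) in H2; auto with cont.
  replace (INR (fact (S k)) / lam ^ S (S k)) with
    (/ lam * (INR (S k) * (INR (fact k) / lam ^ S k))).
  + apply (Lap_ext _ (fun q => / lam * (lam * q ^ S k))); auto.
    intros; field; lra.
  + rewrite fact_simpl, mult_INR; simpl; field; split; [|lra].
    now apply pow_nonzero, Rgt_not_eq.
Qed.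

(* If [I] is the Laplace transform of [q ^ e * f] at [lam], this is that of
   [q ^ e * rem a f j]. *)
Fixpoint lrem (a : nat -> R) (e : nat) (lam I : R) (j : nat) : R :=
  match j with
  | O => I
  | S i => a i * (INR (fact (2 * i + e)) / lam ^ (2 * i + e + 1)) - lrem a e lam I i
  end.

Lemma rem_cont (a : nat -> R) (f : R -> R) (j : nat) : cont f -> cont (rem a f j).
Proof.
intros Hf; induction j as [|j IH]; cbn [rem]; auto.
apply cont_minus; auto with cont.
Qed.

Lemma Lap_rem (a : nat -> R) (f : R -> R) (e : nat) (lam I : R) (j : nat) :
  0 < lam -> cont f -> Lap lam (fun q => q ^ e * f q) I ->
  Lap lam (fun q => q ^ e * rem a f j q) (lrem a e lam I j).
Proof.
intros Hl Hf HI; induction j as [|j IH]; auto.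
cbn [rem lrem].
apply (Lap_ext _ (fun q => a j * q ^ (2 * j + e) - q ^ e * rem a f j q)).
- intros q _; rewrite pow_add, pow_mult; ring.
- apply Lap_minus; auto.
  + auto with cont.
  + assert (Hr := rem_cont a f j Hf); auto with cont.
  + apply Lap_scal; auto with cont.
    replace (2 * j + e + 1)%nat with (S (2 * j + e)) by lia.
    now apply Lap_pow.
Qed.

Lemma lrem_ge0 (J : nat) (a : nat -> R) (f : R -> R) (e : nat) (lam I : R) (j : nat) :
  0 < lam -> cont f -> alt J a f -> Lap lam (fun q => q ^ e * f q) I -> (j <= J)%nat ->
  0 <= lrem a e lam I j.
Proof.
intros Hl Hf Ha HI Hj.
assert (Hr := rem_cont a f j Hf).
apply (Lap_ge0 lam (fun q => q ^ e * rem a f j q)); auto with cont.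
- intros q Hq; apply Rmult_le_pos; [apply pow_le; lra|now apply Ha].
- now apply Lap_rem.
Qed.

Lemma lrem_gt0 (J : nat) (a : nat -> R) (f : R -> R) (e : nat) (lam I : R) (j : nat) :
  0 < lam -> cont f -> (forall q, q <> 0 -> 0 < rem a f j q) ->
  Lap lam (fun q => q ^ e * f q) I -> 0 < lrem a e lam I j.
Proof.
intros Hl Hf Ha HI.
assert (Hr := rem_cont a f j Hf).
apply (Lap_gt0 lam (fun q => q ^ e * rem a f j q)); auto with cont.
- intros q Hq; apply Rmult_lt_0_compat; [now apply pow_lt|apply Ha; lra].
- now apply Lap_rem.
Qed.

Lemma Lap_alt_ex (a : nat -> R) (f : R -> R) (e : nat) (lam : R) :
  0 < lam -> cont f -> alt 1 a f -> exists I, Lap lam (fun q => q ^ e * f q) I.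
Proof.
intros Hl Hf Ha.
apply (Lap_ex_le lam _ (fun q => a O * q ^ e) (a O * (INR (fact e) / lam ^ S e)));
  auto with cont.
- intros q Hq; assert (0 <= q ^ e) by (apply pow_le; lra).
  generalize (Ha 0%nat ltac:(lia) q) (Ha 1%nat ltac:(lia) q); simpl; nra.
- apply Lap_scal; auto with cont; now apply Lap_pow.
Qed.

(** Frullani's integrand, completed at 0 by its limit. *)
Definition exp_slope (c q : R) : R := if Req_EM_T q 0 then c else (1 - exp (- c * q)) / q.

Lemma exp_slope_cont (c : R) : cont (exp_slope c).
Proof.
apply (cont_removable (exp_slope c) (fun q => 1 - exp (- c * q)) (fun q => q)); auto with cont.
- assert (D : is_derive (fun q => 1 - exp (- c * q)) 0 c).
  { auto_derive; auto; rewrite Rmult_0_r, exp_0; ring. }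
  apply is_derive_Reals in D.
  apply (filterlim_locally (exp_slope c)); intros eps.
  destruct (D eps (cond_pos eps)) as [d Hd]; exists d; intros x Hx.
  unfold ball in *; simpl in *; unfold AbsRing_ball, abs, minus, plus, opp in *; simpl in *.
  unfold exp_slope; destruct (Req_EM_T 0 0) as [_|H]; [|lra].
  destruct (Req_EM_T x 0) as [_|Hx0].
  + rewrite Rplus_opp_r, Rabs_R0; apply cond_pos.
  + rewrite Ropp_0, Rplus_0_r in Hx; specialize (Hd x Hx0 Hx).
    rewrite Rplus_0_l, Rmult_0_r, exp_0 in Hd.
    replace ((1 - exp (- c * x)) / x + - c) with
      ((1 - exp (- c * x) - (1 - 1)) / x - c) by (field; auto); auto.
- intros q Hq; unfold exp_slope; destruct (Req_EM_T q 0); [contradiction|auto].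
Qed.
#[global] Hint Resolve exp_slope_cont : cont.

Lemma exp_slope_derive (b q : R) : is_derive (fun b => exp_slope b q) b (exp (- b * q)).
Proof.
unfold exp_slope; destruct (Req_EM_T q 0) as [->|Hq].
- rewrite Rmult_0_r, exp_0; auto_derive; auto.
- auto_derive; auto; field; auto.
Qed.

Lemma exp_le_compat (x sech_conical : R) : x <= sech_conical -> exp x <= exp sech_conical.
Proof. intros [H| ->]; [now apply Rlt_le, exp_increasing|lra]. Qed.

Lemma RInt_exp (a T : R) : a <> 0 ->
  @eq R (RInt (fun q => exp (- a * q)) 0 T) ((1 - exp (- a * T)) / a).
Proof.
intros Ha.
rewrite (RInt_ftc_punctured (fun q => - / a * exp (- a * q))); auto with cont.
- rewrite Rmult_0_r, exp_0; field; auto.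
- intros x _; auto_derive; auto; field; auto.
Qed.

Lemma RInt_exp_slope_derive (a T b : R) : a + b <> 0 ->
  is_derive (fun b => RInt (fun q => exp (- a * q) * exp_slope b q) 0 T) b
    ((1 - exp (- (a + b) * T)) / (a + b)).
Proof.
intros Hab.
assert (D : forall b q, is_derive (fun b => exp (- a * q) * exp_slope b q) b (exp (- (a + b) * q))).
{ clear b Hab; intros b q.
  replace (- (a + b) * q) with (- a * q + - b * q) by ring; rewrite exp_plus.
  apply is_derive_scal, exp_slope_derive. }
evar_last.
- apply (is_derive_RInt_param (fun b q => exp (- a * q) * exp_slope b q)).
  + apply filter_forall; intros b' t _; eexists; apply D.
  + intros t _.
    apply (continuity_2d_pt_ext (fun b q => exp (- (a + b) * q))).
    * intros x z; symmetry; apply is_derive_unique, D.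
    * apply (continuity_1d_2d_pt_comp exp (fun b q => - (a + b) * q)).
      -- apply continuity_pt_filterlim, cont_exp.
      -- apply continuity_2d_pt_mult; [|apply continuity_2d_pt_id2].
         apply continuity_2d_pt_opp, continuity_2d_pt_plus;
           [apply continuity_2d_pt_const|apply continuity_2d_pt_id1].
  + apply filter_forall; intros b'; apply ex_RInt_cont; auto with cont.
- rewrite <- RInt_exp by auto; apply RInt_eq; intros q; apply is_derive_unique, D.
Qed.

(** On [[0, T]] the integral minus [ln (a + b)] has derivative [- exp (- (a + b) T)/(a + b)] in [b];
    the mean value theorem on [[0, c]] bounds the error by [c/a exp (- a T)]. *)
Lemma Lap_frullani (a c : R) : 0 < a -> 0 < c -> Lap a (exp_slope c) (ln ((a + c) / a)).
Proof.
intros Ha Hc.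
apply (is_lim_seq_le_le
  (fun n => ln ((a + c) / a) - c / a * (exp (- a * INR n) * INR n ^ 0)) _
  (fun n => ln ((a + c) / a) + c / a * (exp (- a * INR n) * INR n ^ 0))).
- intros n; set (T := INR n); assert (HT : 0 <= T) by apply pos_INR.
  set (G := fun b => RInt (fun q => exp (- a * q) * exp_slope b q) 0 T - ln (a + b)).
  destruct (MVT_gen G 0 c (fun b => - (exp (- (a + b) * T) / (a + b)))) as [x [Hx E]].
  + rewrite Rmin_left, Rmax_right by lra; intros x Hx.
    evar_last.
    * apply (is_derive_minus (K:=R_AbsRing) (V:=R_NormedModule)); [apply RInt_exp_slope_derive; lra|].
      instantiate (1 := / (a + x)).
      auto_derive; [lra|ring].
    * unfold minus, plus, opp; simpl; field; lra.
  + rewrite Rmin_left, Rmax_right by lra; intros x Hx.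
    apply continuity_pt_filterlim, (continuous_minus (V:=R_NormedModule)).
    * apply (@ex_derive_continuous R_AbsRing R_NormedModule); eexists.
      apply RInt_exp_slope_derive; lra.
    * apply (@ex_derive_continuous R_AbsRing R_NormedModule).
      auto_derive; lra.
  + rewrite Rmin_left, Rmax_right in Hx by lra.
    assert (E0 : @eq R (RInt (fun q => exp (- a * q) * exp_slope 0 q) 0 T) 0).
    { rewrite (RInt_eq _ (fun _ => 0)).
      - rewrite (RInt_const (V:=R_CompleteNormedModule)); unfold scal; simpl; unfold mult; simpl; ring.
      - intros q; unfold exp_slope; destruct (Req_EM_T q 0); [ring|].
        rewrite Ropp_0, Rmult_0_l, exp_0; unfold Rdiv; ring. }
    unfold G in E; rewrite E0, Rplus_0_r in E.
    rewrite ln_div by lra.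
    assert (B : 0 <= exp (- (a + x) * T) / (a + x) <= / a * exp (- a * T)).
    { split; [apply Rlt_le, Rdiv_lt_0_compat; [apply exp_pos|lra]|].
      unfold Rdiv; rewrite Rmult_comm; apply Rmult_le_compat.
      - apply Rlt_le, Rinv_0_lt_compat; lra.
      - apply Rlt_le, exp_pos.
      - apply Rinv_le_contravar; lra.
      - apply exp_le_compat; nra. }
    set (B1 := exp (- (a + x) * T) / (a + x)) in *.
    replace (c / a * (exp (- a * T) * T ^ 0)) with (c * (/ a * exp (- a * T))) by (simpl; field; lra).
    nra.
- evar_last; [apply is_lim_seq_minus'; [apply is_lim_seq_const|]|].
  + apply (is_lim_seq_scal_l _ (c / a) 0), lim_exp_pow; auto.
  + simpl; f_equal; ring.
- evar_last; [apply is_lim_seq_plus'; [apply is_lim_seq_const|]|].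
  + apply (is_lim_seq_scal_l _ (c / a) 0), lim_exp_pow; auto.
  + simpl; f_equal; ring.
Qed.

(** * Laplace transform of the increments *)

(* [pi (G_N - G_(N-1))] is the Laplace transform of this kernel at [4 N]. *)
Definition landau_kernel (q : R) : R := 4 * (exp (-1 * q) * conical q).

Lemma landau_kernel_cont : cont landau_kernel.
Proof. unfold landau_kernel; auto with cont. Qed.
#[global] Hint Resolve landau_kernel_cont : cont.

Lemma landau_kernel_le (q : R) : 0 < q -> 0 <= landau_kernel q <= 4 * q ^ 0.
Proof.
intros Hq; unfold landau_kernel; assert (H1 := conical_gt0 q); assert (H2 := conical_le1 q).
assert (H3 := exp_pos (-1 * q)).
assert (exp (-1 * q) <= 1) by (rewrite <- exp_0; apply exp_le_compat; lra).
simpl; nra.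
Qed.

Lemma Lap_landau_kernel_ex (lam : R) : 0 < lam -> exists I, Lap lam landau_kernel I.
Proof.
intros Hl; apply (Lap_ex_le lam landau_kernel (fun q => 4 * q ^ 0) (4 * (INR (fact 0) / lam ^ 1)));
  auto using landau_kernel_le with cont.
apply Lap_scal; auto with cont; now apply Lap_pow.
Qed.

Definition LapI (lam : R) (f : R -> R) : R :=
  real (Lim_seq (fun n => RInt (fun q => exp (- lam * q) * f q) 0 (INR n))).

Lemma LapI_spec (lam : R) (f : R -> R) : (exists I, Lap lam f I) -> Lap lam f (LapI lam f).
Proof. intros [I HI]; unfold LapI; rewrite (is_lim_seq_unique _ _ HI); auto. Qed.

Definition LapK (lam : R) : R := LapI lam landau_kernel.

Lemma Lap_landau_kernel (lam : R) : 0 < lam -> Lap lam landau_kernel (LapK lam).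
Proof. intros Hl; now apply LapI_spec, Lap_landau_kernel_ex. Qed.

Lemma LapK_bounds : exists M, 0 <= M /\ forall lam, 1 <= lam ->
  4 / lam - M / lam ^ 2 <= LapK lam <= 4 / lam.
Proof.
destruct (alt_conical1 2) as [a [E Ha]].
assert (Ha1 := alt_coef_ge0 2 a conical 1 Ha ltac:(lia)).
(* From [4 exp (- q) h >= 4 - 4 q - 4 a_1 q^2], whose last two terms transform into [4/lam^2] and
   [8 a_1/lam^3 <= 8 a_1/lam^2]. *)
exists (4 + 8 * a 1%nat); split; [lra|]; intros lam Hl.
assert (Hl0 : 0 < lam) by lra.
split.
- apply Rle_trans with (4 * (INR (fact 0) / lam ^ 1) -
    (4 * (INR (fact 1) / lam ^ 2) + 4 * a 1%nat * (INR (fact 2) / lam ^ 3))).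
  + simpl; apply Rle_trans with (4 / lam - (4 / lam ^ 2 + 8 * a 1%nat / lam ^ 2 * 1)).
    * apply Req_le; field; lra.
    * apply Rle_trans with (4 / lam - (4 / lam ^ 2 + 8 * a 1%nat / lam ^ 2 * (/ lam))).
      -- apply Rplus_le_compat_l, Ropp_le_contravar, Rplus_le_compat_l, Rmult_le_compat_l.
         ++ apply Rmult_le_pos; [lra|apply Rlt_le, Rinv_0_lt_compat, pow_lt; lra].
         ++ rewrite <- Rinv_1; apply Rinv_le_contravar; lra.
      -- apply Req_le; field; lra.
  + apply (Lap_le lam (fun q => 4 * q ^ 0 - (4 * q ^ 1 + 4 * a 1%nat * q ^ 2)) landau_kernel); auto 9 with cont.
    * intros q Hq; unfold landau_kernel.
      assert (H1 := alt_rem_le 2 a conical 1 q Ha ltac:(lia)); simpl in H1; rewrite E in H1.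
      assert (H2 := exp_ineq1_le (-1 * q)); assert (H3 := conical_gt0 q); assert (H4 := conical_le1 q).
      assert (H5 := exp_pos (-1 * q)).
      assert (exp (-1 * q) <= 1) by (rewrite <- exp_0; apply exp_le_compat; lra).
      simpl; nra.
    * apply Lap_minus; auto 9 with cont.
      -- apply Lap_scal; auto with cont; now apply Lap_pow.
      -- apply Lap_plus; auto with cont; apply Lap_scal; auto with cont; now apply Lap_pow.
    * now apply Lap_landau_kernel.
- replace (4 / lam) with (4 * (INR (fact 0) / lam ^ 1)) by (simpl; field; lra).
  apply (Lap_le lam landau_kernel (fun q => 4 * q ^ 0)); auto with cont.
  + intros q Hq; now apply landau_kernel_le.
  + now apply Lap_landau_kernel.
  + apply Lap_scal; auto with cont; now apply Lap_pow.
Qed.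

Lemma sinh_2x_exp (q : R) : sinh (2 * q) = (exp q ^ 2 - / exp q ^ 2) / 2.
Proof.
unfold sinh; rewrite exp_Ropp; replace (2 * q) with (q + q) by ring; rewrite exp_plus.
simpl; rewrite !Rmult_1_r; auto.
Qed.

Lemma Phi_bounds (q : R) : 0 < q -> 0 <= Phi q <= q * exp q ^ 2.
Proof.
intros Hq; assert (Hs := sinh_gt0 (2 * q) ltac:(lra)).
replace (Phi q) with (q * sinh (2 * q) * slope q) by (rewrite slope_Phi by lra; field; lra).
assert (HL0 := slope_ge0 q); assert (HL := slope_le1 q).
assert (He : 0 < exp q ^ 2) by apply pow_lt, exp_pos.
assert (Hi : 0 < / exp q ^ 2) by now apply Rinv_0_lt_compat.
assert (Hs2 : sinh (2 * q) <= exp q ^ 2) by (rewrite sinh_2x_exp; lra).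
split.
- apply Rmult_le_pos; auto; apply Rmult_le_pos; lra.
- rewrite Rmult_assoc; apply Rmult_le_compat_l; [lra|]; nra.
Qed.

Lemma LapK_rec (M : R) : 2 <= M ->
  M ^ 2 * LapK (4 * M) = (M - 1 / 2) ^ 2 * LapK (4 * (M - 1)).
Proof.
intros HM.
(* Lagrange's identity for the operator [(sinh (2 q) f')']: [F] is half of
   [sinh (2 q) (h' v - h v')] with [v = exp (- (4 M - 1) q)]. Since [h] solves the equation, [F']
   involves [h] alone, with exactly the coefficients [M^2] and [(M - 1/2)^2]. *)
set (F := fun q => exp (- (4 * M) * q) *
  (- (1 / 2) * exp q * Phi q + (M - 1 / 4) * (exp q ^ 3 - exp (-1 * q)) * conical q)).
assert (CF : cont F) by (unfold F; auto 9 with cont).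
assert (H : Lap (4 * M) (fun q => M ^ 2 * landau_kernel q - (M - 1 / 2) ^ 2 * (exp (- -4 * q) * landau_kernel q)) (0 - F 0)).
{ apply Lap_ftc; auto 9 with cont.
  - intros q Hq.
    assert (Dh := conical_derive q Hq); assert (DP := Phi_derive q).
    assert (Hs : sinh (2 * q) <> 0) by (apply sinh_neq0; lra).
    unfold F; auto_derive; [split; [eexists; exact DP|split; [eexists; exact Dh|auto]]|].
    change (fun x => conical x) with conical; change (fun x => Phi x) with Phi.
    rewrite (is_derive_unique _ _ _ Dh), (is_derive_unique _ _ _ DP).
    unfold landau_kernel; rewrite sinh_2x_exp in Hs |- *.
    replace (- -4 * q) with (q + q + q + q) by ring.
    replace (-1 * q) with (- q) by ring; replace (- (1) * q) with (- q) by ring.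
    rewrite !exp_plus, exp_Ropp.
    assert (He := exp_pos q); set (X := exp q) in *; clearbody X.
    field; split; [lra|].
    intros E; apply Hs.
    replace ((X ^ 2 - / X ^ 2) / 2) with (((X * X) ^ 2 - 1) / (2 * X ^ 2)) by (field; lra).
    rewrite E; unfold Rdiv; ring.
  - apply (is_lim_seq_abs_0 (fun n => F (INR n))).
    apply (is_lim_seq_le_le (fun _ => 0) _
      (fun n => exp (- (1) * INR n) * INR n ^ 1 + M * (exp (- (1) * INR n) * INR n ^ 0))).
    + intros n; split; [apply Rabs_pos|].
      destruct n as [|n].
      * unfold F; simpl INR; rewrite Phi_0, !Rmult_0_r, !exp_0.
        rewrite Rabs_right; simpl; nra.
      * set (q := INR (S n)); assert (Hq : 0 < q) by (apply lt_0_INR; lia).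
        assert (HP := Phi_bounds q Hq); assert (H1 := conical_gt0 q); assert (H2 := conical_le1 q).
        unfold F; rewrite Rabs_mult, (Rabs_pos_eq (exp _)) by apply Rlt_le, exp_pos.
        replace (exp (- (4 * M) * q)) with (exp (- (4 * M - 4) * q) * / exp q ^ 4).
        2:{ rewrite <- exp_INR_mult, <- exp_Ropp, <- exp_plus; f_equal; simpl; ring. }
        replace (exp (-1 * q)) with (/ exp q) by (rewrite <- exp_Ropp; f_equal; ring).
        replace (exp (- (1) * q)) with (/ exp q) by (rewrite <- exp_Ropp; f_equal; ring).
        assert (E1 : exp (- (4 * M - 4) * q) <= 1) by (rewrite <- exp_0; apply exp_le_compat; nra).
        assert (E0 := exp_pos (- (4 * M - 4) * q)).
        assert (He : 1 < exp q) by (rewrite <- exp_0; now apply exp_increasing).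
        set (X := exp q) in *; clearbody X.
        set (Y := exp (- (4 * M - 4) * q)) in *; clearbody Y.
        assert (Hi : 0 < / X) by (apply Rinv_0_lt_compat; lra).
        assert (Hi1 : / X < 1) by (rewrite <- Rinv_1; apply Rinv_lt_contravar; lra).
        (* The bracket grows at most like [exp (3 q) (q + M)], so a factor [exp (-4 q)] taken from
           [exp (-4 M q)] still leaves decay. *)
        assert (B : Rabs (- (1 / 2) * X * Phi q + (M - 1 / 4) * (X ^ 3 - / X) * conical q)
          <= X ^ 3 * (q + M)).
        { set (D := X ^ 3 - / X).
          assert (HX3 : 1 <= X ^ 3) by (apply pow_R1_Rle; lra).
          assert (HD : 0 <= D <= X ^ 3) by (unfold D; lra).
          assert (HDh : 0 <= D * conical q <= X ^ 3).
          { split; [apply Rmult_le_pos; lra|].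
            rewrite <- (Rmult_1_r (X ^ 3)); apply Rmult_le_compat; lra. }
          assert (HXP : 0 <= X * Phi q <= X ^ 3 * q).
          { split; [apply Rmult_le_pos; lra|].
            replace (X ^ 3 * q) with (X * (q * X ^ 2)) by ring.
            apply Rmult_le_compat_l; lra. }
          replace (- (1 / 2) * X * Phi q + (M - 1 / 4) * D * conical q) with
            ((M - 1 / 4) * (D * conical q) - 1 / 2 * (X * Phi q)) by ring.
          rewrite Rmult_plus_distr_l.
          assert (T1 : 0 <= (M - 1 / 4) * (D * conical q) <= (M - 1 / 4) * X ^ 3).
          { split; [apply Rmult_le_pos|apply Rmult_le_compat_l]; lra. }
          assert (T2 : 0 <= X ^ 3 * q) by (apply Rmult_le_pos; lra).
          assert (T3 : 0 <= M * X ^ 3) by (apply Rmult_le_pos; lra).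
          apply Rabs_le; lra. }
        assert (HX4 : 0 < / X ^ 4) by (apply Rinv_0_lt_compat, pow_lt; lra).
        apply Rle_trans with (1 * / X ^ 4 * (X ^ 3 * (q + M))).
        -- apply Rmult_le_compat; auto; [|apply Rabs_pos|].
           ++ apply Rmult_le_pos; lra.
           ++ apply Rmult_le_compat_r; lra.
        -- apply Req_le; simpl; field; lra.
    + apply is_lim_seq_const.
    + evar_last; [apply is_lim_seq_plus'|].
      * apply lim_exp_pow; lra.
      * apply (is_lim_seq_scal_l _ M 0), lim_exp_pow; lra.
      * simpl; f_equal; ring. }
assert (F0 : F 0 = 0).
{ unfold F; rewrite Phi_0, !Rmult_0_r, !exp_0; ring. }
assert (H1 : Lap (4 * M) landau_kernel (LapK (4 * M))) by (apply Lap_landau_kernel; lra).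
assert (H2 : Lap (4 * M) (fun q => exp (- -4 * q) * landau_kernel q) (LapK (4 * (M - 1)))).
{ apply Lap_shift; replace (4 * M + -4) with (4 * (M - 1)) by ring; apply Lap_landau_kernel; lra. }
assert (H3 : Lap (4 * M) (fun q => M ^ 2 * landau_kernel q - (M - 1 / 2) ^ 2 * (exp (- -4 * q) * landau_kernel q))
  (M ^ 2 * LapK (4 * M) - (M - 1 / 2) ^ 2 * LapK (4 * (M - 1)))).
{ apply Lap_minus; auto 9 with cont; apply Lap_scal; auto with cont. }
assert (E := Lap_unique _ _ _ _ H H3); lra.
Qed.

(** * Asymptotic expansion of the Laplace transform *)

Lemma Lap_csch_defect (lam : R) : 0 < lam -> Lap lam csch_defect (LapI lam csch_defect).
Proof.
intros Hl; apply LapI_spec; destruct (csch_defect_Alt 2 ltac:(lia)) as [g [G1 [G2 [b Hb]]]].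
destruct (Lap_alt_ex b g 1 lam Hl G1) as [I HI]; [now apply (alt_le 1 2); auto|].
exists I; eapply Lap_ext; [|exact HI]; intros q _; simpl; rewrite G2; ring.
Qed.

Lemma Lap_sech_conical (lam : R) : 0 < lam -> Lap lam sech_conical (LapI lam sech_conical).
Proof.
intros Hl; apply LapI_spec; destruct (alt_sech_conical 1) as [a [Ha _]].
destruct (Lap_alt_ex a sech_conical 0 lam Hl sech_conical_cont Ha) as [I HI].
exists I; eapply Lap_ext; [|exact HI]; intros q _; simpl; ring.
Qed.

#[global] Hint Resolve csch_defect_cont sech_conical_cont : cont.

(** At [lam = 4 N] this is the error of order 0, as [landau_error0_Psi] shows. *)
Definition Psi (lam : R) : R := LapI lam csch_defect - LapI lam sech_conical.

(** Raising the parameter by 4 multiplies the kernel by [exp (-4 q)], and [(1 - exp (-4 q)) (w - y)]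
    collapses to Frullani's integrand minus [landau_kernel]. *)
Lemma Psi_diff (lam : R) : 0 < lam ->
  Psi (lam + 4) - Psi lam = LapK lam - ln ((lam + 4) / lam).
Proof.
intros Hl.
assert (H1 : Lap lam (fun q => csch_defect q - sech_conical q) (Psi lam)).
{ apply Lap_minus; auto with cont; [now apply Lap_csch_defect|now apply Lap_sech_conical]. }
assert (H2 : Lap lam (fun q => exp (- (4) * q) * (csch_defect q - sech_conical q)) (Psi (lam + 4))).
{ apply (Lap_shift lam 4 (fun q => csch_defect q - sech_conical q)), Lap_minus; auto with cont;
    [apply Lap_csch_defect|apply Lap_sech_conical]; lra. }
assert (H3 : Lap lam (fun q => (csch_defect q - sech_conical q) - exp (- (4) * q) * (csch_defect q - sech_conical q))
  (ln ((lam + 4) / lam) - LapK lam)).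
{ apply (Lap_ext _ (fun q => exp_slope 4 q - landau_kernel q)).
  - intros q Hq.
    assert (Hs := sinh_gt0 q Hq); assert (Hc := cosh_gt0 q).
    unfold csch_defect, sech_conical, exp_slope, landau_kernel; destruct (Req_EM_T q 0) as [E|_]; [lra|].
    replace (exp (- (4) * q)) with (/ exp q ^ 4).
    2:{ rewrite <- exp_INR_mult, <- exp_Ropp; f_equal; simpl; ring. }
    replace (exp (-1 * q)) with (/ exp q) by (rewrite <- exp_Ropp; f_equal; ring).
    unfold sinh, cosh in *; rewrite exp_Ropp in *.
    assert (He := exp_pos q); set (X := exp q) in *; clearbody X.
    assert (X <> 0) by lra.
    assert (X * X - 1 <> 0).
    { intros E; replace ((X - / X) / 2) with ((X * X - 1) / (2 * X)) in Hs by (field; lra).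
      rewrite E in Hs; unfold Rdiv in Hs; lra. }
    assert (X * X + 1 <> 0) by nra.
    field; repeat split; auto; lra.
  - apply Lap_minus; auto with cont; [apply Lap_frullani; lra|now apply Lap_landau_kernel]. }
assert (H4 : Lap lam (fun q => (csch_defect q - sech_conical q) - exp (- (4) * q) * (csch_defect q - sech_conical q))
  (Psi lam - Psi (lam + 4))) by (apply Lap_minus; auto with cont).
assert (E := Lap_unique _ _ _ _ H3 H4); lra.
Qed.

Lemma lrem_le (J : nat) (a : nat -> R) (f : R -> R) (e : nat) (lam I : R) (j : nat) :
  0 < lam -> cont f -> alt J a f -> Lap lam (fun q => q ^ e * f q) I -> (j < J)%nat ->
  lrem a e lam I j <= a j * (INR (fact (2 * j + e)) / lam ^ (2 * j + e + 1)).
Proof.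
intros Hl Hf Ha HI Hj.
generalize (lrem_ge0 J a f e lam I (S j) Hl Hf Ha HI Hj); cbn [lrem]; lra.
Qed.

Lemma Nn_ge1 (n : nat) : 1 <= INR (n + 1).
Proof. rewrite plus_INR; generalize (pos_INR n); simpl; lra. Qed.

(** The exponent [m] is left free because after an odd order one part decays faster than
    required. *)
Lemma lrem_bound (J : nat) (a : nat -> R) (f : R -> R) (e : nat) (I : nat -> R) (j m : nat) :
  cont f -> alt J a f ->
  (forall n, Lap (4 * INR (n + 1)) (fun q => q ^ e * f q) (I n)) ->
  (j < J)%nat -> (m <= 2 * j + e + 1)%nat ->
  exists B, 0 <= B /\ forall n, 0 <= lrem a e (4 * INR (n + 1)) (I n) j <= B / INR (n + 1) ^ m.
Proof.
intros Hf Ha HI Hj Hm.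
assert (Haj := alt_coef_ge0 J a f j Ha Hj).
assert (HF : 0 < INR (fact (2 * j + e))) by apply lt_0_INR, lt_O_fact.
assert (HB : 0 <= a j * INR (fact (2 * j + e))) by (apply Rmult_le_pos; lra).
exists (a j * INR (fact (2 * j + e))); split; auto; intros n.
assert (HN := Nn_ge1 n); set (N := INR (n + 1)) in *.
split.
- apply (lrem_ge0 J a f); auto; [lra|apply HI|lia].
- eapply Rle_trans; [apply (lrem_le J a f); auto; [lra|apply HI]|].
  unfold Rdiv; rewrite <- Rmult_assoc; apply Rmult_le_compat_l; auto.
  apply Rinv_le_contravar; [apply pow_lt; lra|].
  apply Rle_trans with (N ^ (2 * j + e + 1)).
  + apply Rle_pow; auto.
  + apply pow_incr; lra.
Qed.

(** * Polynomials in [1/N] and uniqueness of expansions *)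

Definition Poly (l : nat) (P : nat -> R) : Prop :=
  exists c : nat -> R, forall n, P n = sum_n_m (fun k => c k / INR (n + 1) ^ k) 1 l.

Lemma Poly_ext (l : nat) (P Q : nat -> R) : (forall n, P n = Q n) -> Poly l P -> Poly l Q.
Proof. intros E [c Hc]; exists c; intros n; now rewrite <- E. Qed.

Lemma Poly_lin (l : nat) (u : R) (P Q : nat -> R) : Poly l P -> Poly l Q ->
  Poly l (fun n => u * P n + Q n).
Proof.
intros [c Hc] [d Hd]; exists (fun k => u * c k + d k); intros n; rewrite Hc, Hd.
change (u * sum_n_m (fun k => c k / INR (n + 1) ^ k) 1 l) with
  (mult u (sum_n_m (fun k => c k / INR (n + 1) ^ k) 1 l)).
rewrite <- (sum_n_m_mult_l (K:= R_Ring)).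
etransitivity; [symmetry; apply (sum_n_m_plus (G := R_AbelianMonoid))|].
apply sum_n_m_ext; intros k; unfold plus, mult; simpl; unfold Rdiv; ring.
Qed.

Lemma Poly_0 (l : nat) : Poly l (fun _ => 0).
Proof.
exists (fun _ => 0); intros n; symmetry.
etransitivity; [|apply (sum_n_m_const_zero (G := R_AbelianMonoid) 1 l)].
apply sum_n_m_ext; intros k; unfold Rdiv; rewrite Rmult_0_l; reflexivity.
Qed.

Lemma sum_n_m_S (f : nat -> R) (l : nat) :
  sum_n_m f 1 (S l) = sum_n_m f 1 l + f (S l).
Proof. apply (sum_n_Sm (G := R_AbelianMonoid)); lia. Qed.

Lemma Poly_mono (l k : nat) (c : R) : (1 <= k <= l)%nat ->
  Poly l (fun n => c / INR (n + 1) ^ k).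
Proof.
intros Hk; exists (fun i => if Nat.eqb i k then c else 0); intros n.
induction l as [|l IH]; [lia|].
rewrite sum_n_m_S.
destruct (Nat.eqb_spec (S l) k) as [<-|E].
- rewrite (sum_n_m_ext_loc _ (fun _ => zero)).
  + rewrite sum_n_m_const_zero; unfold zero; simpl; ring.
  + intros i Hi; destruct (Nat.eqb_spec i (S l)); [lia|].
    unfold zero; simpl; unfold Rdiv; ring.
- rewrite <- IH by lia; unfold Rdiv; ring.
Qed.

(** What the remainder leaves behind has the powers [2 i + e + 1 + s] of [1/N] with [i < j], the
    largest being [2 j + e + s - 1]. *)
Lemma Poly_lrem (l : nat) (a : nat -> R) (e s : nat) (I : nat -> R) (j : nat) :
  (2 * j + e + s <= S l)%nat ->
  Poly l (fun n => (I n - (-1) ^ j * lrem a e (4 * INR (n + 1)) (I n) j) / INR (n + 1) ^ s).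
Proof.
induction j as [|j IH]; intros Hj.
- apply (Poly_ext l (fun _ => 0)); [|apply Poly_0].
  intros n; simpl; unfold Rdiv; ring.
- specialize (IH ltac:(lia)).
  apply (Poly_ext l (fun n => (- ((-1) ^ S j * (a j * (INR (fact (2 * j + e)) / 4 ^ (2 * j + e + 1))))) *
     (1 / INR (n + 1) ^ (2 * j + e + 1 + s)) +
     (I n - (-1) ^ j * lrem a e (4 * INR (n + 1)) (I n) j) / INR (n + 1) ^ s)).
  + intros n; assert (HN := Nn_ge1 n); set (N := INR (n + 1)) in *.
    cbn [lrem]; rewrite (pow_add N (2 * j + e + 1) s), Rpow_mult_distr; simpl ((-1) ^ S j).
    field; repeat split; apply pow_nonzero; lra.
  + apply Poly_lin; auto; apply Poly_mono; lia.
Qed.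

Lemma lim_inv_Nn : is_lim_seq (fun n => / INR (n + 1)) 0.
Proof.
apply (is_lim_seq_incr_n (fun n => / INR n) 1).
apply (is_lim_seq_inv INR p_infty); [apply is_lim_seq_INR|discriminate].
Qed.

(** Multiplication by [N] isolates [c 1] up to a term tending to 0 and lowers both the degree and
    the order of the bound by one. *)
Lemma asymptotic_unique (l : nat) (c : nat -> R) (B : R) :
  eventually (fun n => Rabs (sum_n_m (fun k => c k / INR (n + 1) ^ k) 1 l)
    <= B / INR (n + 1) ^ (l + 1)) ->
  forall k, (1 <= k <= l)%nat -> c k = 0.
Proof.
revert c; induction l as [|l IH]; intros c H k Hk; [lia|].
assert (E : forall n, INR (n + 1) * sum_n_m (fun k => c k / INR (n + 1) ^ k) 1 (S l) =
   c 1%nat + sum_n_m (fun k => c (S k) / INR (n + 1) ^ k) 1 l).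
{ intros n; assert (HN := Nn_ge1 n); set (N := INR (n + 1)) in *.
  clear - HN; induction l as [|l IH].
  - rewrite sum_n_n, sum_n_m_zero by lia; unfold zero; simpl; field; lra.
  - rewrite sum_n_m_S, Rmult_plus_distr_l, IH, sum_n_m_S.
    simpl; field; split; [apply pow_nonzero|]; lra. }
assert (L0 : forall d, is_lim_seq (fun n => sum_n_m (fun k => d k / INR (n + 1) ^ k) 1 l) 0).
{ intros d; clear - d; induction l as [|l IH].
  - apply (is_lim_seq_ext (fun _ => 0)); [|apply is_lim_seq_const].
    intros n; rewrite sum_n_m_zero by lia; reflexivity.
  - apply (is_lim_seq_ext (fun n => sum_n_m (fun k => d k / INR (n + 1) ^ k) 1 l
      + d (S l) * (/ INR (n + 1)) ^ S l)).
    + intros n; rewrite sum_n_m_S, pow_inv; reflexivity.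
    + replace (Finite 0) with (Finite (0 + d (S l) * 0 ^ S l)) by (f_equal; simpl; ring).
      apply is_lim_seq_plus'; auto.
      apply (is_lim_seq_scal_l _ (d (S l)) (0 ^ S l)).
      generalize (S l); intros m; induction m as [|m IHm].
      * apply is_lim_seq_const.
      * simpl; apply is_lim_seq_mult'; auto using lim_inv_Nn. }
assert (H' : eventually (fun n => Rabs (c 1%nat + sum_n_m (fun k => c (S k) / INR (n + 1) ^ k) 1 l)
   <= B / INR (n + 1) ^ (l + 1))).
{ eapply filter_imp; [|exact H]; intros n Hn; cbv beta in Hn.
  assert (HN := Nn_ge1 n); rewrite <- E, Rabs_mult, (Rabs_pos_eq (INR (n + 1))) by lra.
  apply Rle_trans with (INR (n + 1) * (B / INR (n + 1) ^ (S l + 1))).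
  - apply Rmult_le_compat_l; lra.
  - apply Req_le; simpl; field; split; [apply pow_nonzero|]; lra. }
assert (C1 : c 1%nat = 0).
{ assert (T1 : is_lim_seq (fun n => c 1%nat + sum_n_m (fun k => c (S k) / INR (n + 1) ^ k) 1 l)
    (c 1%nat + 0)) by (apply is_lim_seq_plus'; [apply is_lim_seq_const|apply L0]).
  assert (T2 : is_lim_seq (fun n => c 1%nat + sum_n_m (fun k => c (S k) / INR (n + 1) ^ k) 1 l) 0).
  { apply is_lim_seq_abs_0.
    apply (is_lim_seq_le_le_loc (fun _ => 0) _ (fun n => Rabs B * / INR (n + 1))).
    - eapply filter_imp; [|exact H']; intros n Hn; cbv beta in Hn.
      split; [apply Rabs_pos|]; eapply Rle_trans; [exact Hn|].
      assert (HN := Nn_ge1 n); unfold Rdiv.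
      apply Rle_trans with (Rabs B * / INR (n + 1) ^ (l + 1)).
      + apply Rmult_le_compat_r; [apply Rlt_le, Rinv_0_lt_compat, pow_lt; lra|apply Rle_abs].
      + apply Rmult_le_compat_l; [apply Rabs_pos|].
        apply Rinv_le_contravar; [lra|].
        rewrite <- (pow_1 (INR (n + 1))) at 1; apply Rle_pow; auto; lia.
    - apply is_lim_seq_const.
    - replace (Finite 0) with (Rbar_mult (Rabs B) 0) by (simpl; f_equal; ring).
      apply is_lim_seq_scal_l, lim_inv_Nn. }
  apply is_lim_seq_unique in T1; apply is_lim_seq_unique in T2.
  rewrite T1 in T2; injection T2; lra. }
destruct k as [|[|k]]; [lia|auto|].
apply (IH (fun k => c (S k))); [|lia].
eapply filter_imp; [|exact H']; intros n Hn; cbv beta in Hn.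
now rewrite C1, Rplus_0_l in Hn.
Qed.

(** * Identification of the error of order 0 *)

Lemma landau_error_split (alpha : nat -> R) (l n : nat) :
  landau_error alpha l n = landau_error alpha 0 n -
    sum_n_m (fun k => alpha k / INR (n + 1) ^ k) 1 l.
Proof.
unfold landau_error; rewrite (sum_n_m_zero _ 1 0) by lia; unfold zero; simpl; ring.
Qed.

Lemma Nn_S (n : nat) : INR (S n + 1) = INR (n + 1) + 1.
Proof. apply (S_INR (n + 1)). Qed.

Lemma landau_error0_diff (alpha : nat -> R) (n : nat) :
  landau_error alpha 0 (S n) - landau_error alpha 0 n =
  PI * odd_even_ratio (S n) ^ 2 - ln ((INR (n + 1) + 1) / INR (n + 1)).
Proof.
assert (HN := Nn_ge1 n).
assert (Z : forall f : nat -> R, @eq R (sum_n_m f 1 0) 0)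
  by (intros f; apply (sum_n_m_zero f); lia).
unfold landau_error; cbv zeta; rewrite !Z.
rewrite Nn_S.
unfold landau_G; rewrite tech5.
rewrite ln_div, !ln_mult by lra; ring.
Qed.

Lemma odd_even_ratio_gt0 (n : nat) : 0 < odd_even_ratio n.
Proof.
induction n as [|n IH]; [simpl; lra|].
change (0 < odd_even_ratio n * (INR (2 * S n - 1) / INR (2 * S n))).
apply Rmult_lt_0_compat; auto; apply Rdiv_lt_0_compat; apply lt_0_INR; lia.
Qed.

(** Both sides satisfy the recurrence of [LapK_rec], so they agree up to a constant fixed at
    [N = 1]. *)
Lemma LapK_ratio : exists kappa, 0 < kappa /\ forall n,
  LapK (4 * INR (n + 1)) = kappa * odd_even_ratio (S n) ^ 2.
Proof.
assert (Hr := odd_even_ratio_gt0 1).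
assert (Hr2 : 0 < odd_even_ratio 1 ^ 2) by now apply pow_lt.
assert (HV : 0 < LapK 4).
{ apply (Lap_gt0 4 landau_kernel); auto with cont; [|apply Lap_landau_kernel; lra].
  intros q _; unfold landau_kernel; apply Rmult_lt_0_compat; [lra|].
  apply Rmult_lt_0_compat; [apply exp_pos|apply conical_gt0]. }
exists (LapK 4 / odd_even_ratio 1 ^ 2); split; [now apply Rdiv_lt_0_compat|].
induction n as [|n IH].
- replace (4 * INR (0 + 1)) with 4 by (simpl; ring); field.
  simpl in Hr |- *; lra.
- set (M := INR (S n + 1)).
  assert (HM : M = INR (n + 1) + 1) by (apply Nn_S).
  assert (HN := Nn_ge1 n).
  assert (E := LapK_rec M ltac:(lra)).
  replace (M - 1) with (INR (n + 1)) in E by lra; rewrite IH in E.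
  assert (ER : odd_even_ratio (S (S n)) = odd_even_ratio (S n) * ((2 * M - 1) / (2 * M))).
  { change (odd_even_ratio (S (S n))) with
      (odd_even_ratio (S n) * (INR (2 * S (S n) - 1) / INR (2 * S (S n)))).
    unfold M; rewrite minus_INR by lia; rewrite mult_INR.
    replace (S n + 1)%nat with (S (S n)) by lia; reflexivity. }
  rewrite ER; apply Rmult_eq_reg_l with (M ^ 2); [|apply pow_nonzero; lra].
  rewrite E; field; lra.
Qed.

Lemma lim_N_LapK : is_lim_seq (fun n => INR (n + 1) * LapK (4 * INR (n + 1))) 1.
Proof.
destruct LapK_bounds as [B [HB H]].
apply (is_lim_seq_le_le (fun n => 1 - B / 16 * / INR (n + 1)) _ (fun _ => 1)).
- intros n; assert (HN := Nn_ge1 n); set (N := INR (n + 1)) in *.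
  specialize (H (4 * N) ltac:(lra)).
  replace (1 - B / 16 * / N) with (N * (4 / (4 * N) - B / (4 * N) ^ 2)) by (field; lra).
  split; [apply Rmult_le_compat_l; lra|].
  apply Rle_trans with (N * (4 / (4 * N))); [apply Rmult_le_compat_l; lra|].
  apply Req_le; field; lra.
- evar_last; [apply is_lim_seq_minus'; [apply is_lim_seq_const|]|].
  + apply (is_lim_seq_scal_l _ (B / 16) 0), lim_inv_Nn.
  + simpl; f_equal; ring.
- apply is_lim_seq_const.
Qed.

Lemma ln_bounds (x : R) : 1 <= x -> / (x + 1) <= ln ((x + 1) / x) <= / x.
Proof.
intros Hx.
assert (Hu : forall t, 0 < t -> ln t <= t - 1).
{ intros t Ht; rewrite <- (exp_ln t) at 2 by auto.
  generalize (exp_ineq1_le (ln t)); lra. }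
assert (H1 := Hu ((x + 1) / x) ltac:(apply Rdiv_lt_0_compat; lra)).
assert (H2 := Hu (x / (x + 1)) ltac:(apply Rdiv_lt_0_compat; lra)).
replace ((x + 1) / x - 1) with (/ x) in H1 by (field; lra).
replace (x / (x + 1) - 1) with (- / (x + 1)) in H2 by (field; lra).
replace (x / (x + 1)) with (/ ((x + 1) / x)) in H2 by (field; lra).
rewrite ln_Rinv in H2 by (apply Rdiv_lt_0_compat; lra); lra.
Qed.

(** Wallis's limit, extracted from the assumed expansion. Order 1 is taken because the increment
    gets multiplied by [N]: errors of size [1/N] would not vanish, errors of size [1/N^2] do. *)
Lemma lim_N_ratio (alpha : nat -> R) : is_landau_expansion alpha ->
  is_lim_seq (fun n => INR (n + 1) * (PI * odd_even_ratio (S n) ^ 2)) 1.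
Proof.
intros Ha; destruct (Ha 1%nat) as [B HB].
(* After multiplication by [N], the two errors contribute [Rabs B / N] each, the [alpha 1] terms
   [Rabs (alpha 1) / N], and the logarithm differs from 1 by at most [1 / N]. *)
set (D := Rabs B * 2 + Rabs (alpha 1%nat) + 1).
apply (is_lim_seq_le_le_loc (fun n => 1 - D * / INR (n + 1)) _ (fun n => 1 + D * / INR (n + 1))).
- assert (HB' : eventually (fun n => Rabs (landau_error alpha 1 (S n)) <= B / INR (S n + 1) ^ 2)).
  { destruct HB as [n0 Hn0]; exists n0; intros n Hn; apply Hn0; lia. }
  eapply filter_imp; [|exact (filter_and _ _ HB HB')].
  intros n [H1 H2].
  assert (HN := Nn_ge1 n).
  assert (E := landau_error0_diff alpha n).
  assert (E1 := landau_error_split alpha 1 n); rewrite sum_n_n in E1.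
  assert (E2 := landau_error_split alpha 1 (S n)); rewrite sum_n_n in E2.
  rewrite Nn_S in *.
  set (N := INR (n + 1)) in *.
  assert (HL := ln_bounds N HN).
  set (e0 := landau_error alpha 1 n) in *; set (e1 := landau_error alpha 1 (S n)) in *.
  change ((1 + 1)%nat) with 2%nat in H1.
  assert (Hi : 0 < / N) by (apply Rinv_0_lt_compat; lra).
  assert (G : forall t, Rabs t <= Rabs B * (/ N) ^ 2 -> Rabs (N * t) <= Rabs B * / N).
  { intros t Ht; rewrite Rabs_mult, (Rabs_pos_eq N) by lra.
    replace (Rabs B * / N) with (N * (Rabs B * (/ N) ^ 2)) by (field; lra).
    apply Rmult_le_compat_l; lra. }
  assert (G0 : Rabs (N * e0) <= Rabs B * / N).
  { apply G; eapply Rle_trans; [exact H1|]; rewrite pow_inv; apply Rmult_le_compat_r.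
    - apply Rlt_le, Rinv_0_lt_compat, pow_lt; lra.
    - apply Rle_abs. }
  assert (G1 : Rabs (N * e1) <= Rabs B * / N).
  { apply G; eapply Rle_trans; [exact H2|]; rewrite pow_inv.
    apply Rle_trans with (Rabs B * / (N + 1) ^ 2).
    - apply Rmult_le_compat_r; [apply Rlt_le, Rinv_0_lt_compat, pow_lt; lra|apply Rle_abs].
    - apply Rmult_le_compat_l; [apply Rabs_pos|].
      apply Rinv_le_contravar; [apply pow_lt; lra|apply pow_incr; lra]. }
  assert (G2 : 1 - / N <= N * ln ((N + 1) / N) <= 1).
  { split.
    - apply Rle_trans with (N * / (N + 1)); [|apply Rmult_le_compat_l; lra].
      apply Rmult_le_reg_r with (N * (N + 1)); [nra|].
      field_simplify; lra.
    - replace 1 with (N * / N) at 2 by (field; lra); apply Rmult_le_compat_l; lra. }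
  assert (G3 : Rabs (N * (alpha 1%nat / (N + 1) ^ 1 - alpha 1%nat / N ^ 1)) <= Rabs (alpha 1%nat) * / N).
  { replace (N * (alpha 1%nat / (N + 1) ^ 1 - alpha 1%nat / N ^ 1)) with
      (alpha 1%nat * - / (N + 1)) by (field; lra).
    rewrite Rabs_mult, Rabs_Ropp, (Rabs_pos_eq (/ (N + 1)))
      by (apply Rlt_le, Rinv_0_lt_compat; lra).
    apply Rmult_le_compat_l; [apply Rabs_pos|apply Rinv_le_contravar; lra]. }
  replace (N * (PI * odd_even_ratio (S n) ^ 2)) with
   (N * e1 - N * e0 + N * (alpha 1%nat / (N + 1) ^ 1 - alpha 1%nat / N ^ 1) + N * ln ((N + 1) / N)).
  2:{ replace (PI * odd_even_ratio (S n) ^ 2) with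
      (landau_error alpha 0 (S n) - landau_error alpha 0 n + ln ((N + 1) / N)) by lra.
      rewrite E1, E2; ring. }
  apply Rabs_le_between in G0; apply Rabs_le_between in G1; apply Rabs_le_between in G3.
  unfold D; rewrite !Rmult_plus_distr_r; lra.
- evar_last; [apply is_lim_seq_minus'; [apply is_lim_seq_const|]|].
  + apply (is_lim_seq_scal_l _ D 0), lim_inv_Nn.
  + simpl; f_equal; ring.
- evar_last; [apply is_lim_seq_plus'; [apply is_lim_seq_const|]|].
  + apply (is_lim_seq_scal_l _ D 0), lim_inv_Nn.
  + simpl; f_equal; ring.
Qed.

(** Both sequences, multiplied by [N], tend to 1, which forces the constant of [LapK_ratio] to be
    [PI]. *)
Lemma LapK_landau (alpha : nat -> R) : is_landau_expansion alpha -> forall n,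
  LapK (4 * INR (n + 1)) = PI * odd_even_ratio (S n) ^ 2.
Proof.
intros Ha; destruct LapK_ratio as [kappa [Hk E]].
assert (H1 := lim_N_ratio alpha Ha); assert (H2 := lim_N_LapK).
apply (is_lim_seq_scal_l _ (kappa / PI)) in H1.
assert (H3 : is_lim_seq (fun n => INR (n + 1) * LapK (4 * INR (n + 1))) (kappa / PI)).
{ eapply is_lim_seq_ext; [|evar_last; [exact H1|simpl; f_equal; ring]].
  intros n; rewrite E; field; apply PI_neq0. }
apply is_lim_seq_unique in H2; apply is_lim_seq_unique in H3; rewrite H2 in H3.
injection H3; intros H4.
intros n; rewrite E; f_equal; apply Rmult_eq_reg_r with (/ PI).
- rewrite Rinv_r by apply PI_neq0; unfold Rdiv in H4; lra.
- apply Rinv_neq_0_compat, PI_neq0.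
Qed.

Lemma lim_Psi : is_lim_seq (fun n => Psi (4 * INR (n + 1))) 0.
Proof.
destruct (csch_defect_Alt 2 ltac:(lia)) as [g [G1 [G2 [b Hb]]]].
destruct (alt_sech_conical 2) as [a [Ha _]].
destruct (lrem_bound 2 b g 1 (fun n => LapI (4 * INR (n + 1)) csch_defect) 0 1) as [B1 [_ HB1]]; auto; try lia.
{ intros n; assert (HN := Nn_ge1 n).
  eapply Lap_ext; [|apply Lap_csch_defect; lra]; intros q _; simpl; rewrite G2; ring. }
destruct (lrem_bound 2 a sech_conical 0 (fun n => LapI (4 * INR (n + 1)) sech_conical) 0 1) as [B2 [_ HB2]];
  auto with cont; try lia.
{ intros n; assert (HN := Nn_ge1 n).
  eapply Lap_ext; [|apply Lap_sech_conical; lra]; intros q _; simpl; ring. }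
apply (is_lim_seq_le_le (fun n => - B2 * / INR (n + 1)) _ (fun n => B1 * / INR (n + 1))).
- intros n; unfold Psi; specialize (HB1 n); specialize (HB2 n); cbn [lrem] in *.
  rewrite !pow_1 in *; unfold Rdiv in *; lra.
- replace (Finite 0) with (Rbar_mult (- B2) 0) by (simpl; f_equal; ring).
  apply is_lim_seq_scal_l, lim_inv_Nn.
- replace (Finite 0) with (Rbar_mult B1 0) by (simpl; f_equal; ring).
  apply is_lim_seq_scal_l, lim_inv_Nn.
Qed.

Lemma lim_landau_error0 (alpha : nat -> R) : is_landau_expansion alpha ->
  is_lim_seq (landau_error alpha 0) 0.
Proof.
intros Ha; destruct (Ha 0%nat) as [B HB].
apply is_lim_seq_abs_0.
apply (is_lim_seq_le_le_loc (fun _ => 0) _ (fun n => B * / INR (n + 1))).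
- eapply filter_imp; [|exact HB]; intros n Hn; cbv beta in Hn; split; [apply Rabs_pos|].
  rewrite pow_1 in Hn; exact Hn.
- apply is_lim_seq_const.
- replace (Finite 0) with (Rbar_mult B 0) by (simpl; f_equal; ring).
  apply is_lim_seq_scal_l, lim_inv_Nn.
Qed.

(** Both sides have the same increments and tend to 0. *)
Lemma landau_error0_Psi (alpha : nat -> R) : is_landau_expansion alpha ->
  forall n, landau_error alpha 0 n = Psi (4 * INR (n + 1)).
Proof.
intros Ha.
set (D := fun n => landau_error alpha 0 n - Psi (4 * INR (n + 1))).
assert (HS : forall n, D (S n) = D n).
{ intros n; assert (HN := Nn_ge1 n); unfold D.
  assert (E1 := landau_error0_diff alpha n).
  assert (E2 := Psi_diff (4 * INR (n + 1)) ltac:(lra)).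
  rewrite (LapK_landau alpha Ha) in E2.
  replace ((4 * INR (n + 1) + 4) / (4 * INR (n + 1))) with
    ((INR (n + 1) + 1) / INR (n + 1)) in E2 by (field; lra).
  replace (4 * INR (S n + 1)) with (4 * INR (n + 1) + 4) by (rewrite Nn_S; ring).
  lra. }
assert (HD : forall n, D n = D 0%nat) by (induction n as [|n IH]; auto; rewrite HS; auto).
assert (L1 : is_lim_seq D 0).
{ replace (Finite 0) with (Finite (0 - 0)) by (f_equal; ring).
  apply is_lim_seq_minus'; [now apply lim_landau_error0|apply lim_Psi]. }
assert (L2 : is_lim_seq D (D 0%nat)).
{ apply (is_lim_seq_ext (fun _ => D 0%nat)); [now intros|apply is_lim_seq_const]. }
apply is_lim_seq_unique in L1; apply is_lim_seq_unique in L2; rewrite L1 in L2.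
injection L2; intros E n; generalize (HD n); unfold D in *; lra.
Qed.

(** * Signs of the remainders *)

(** The boundary terms vanish, as [w 0 = 0] and [w] grows at most linearly; hence the transform of
    [w'] is [lam] times that of [w]. *)
Lemma Lap_csch_defect_by_parts (lam : R) (E : R -> R) : 0 < lam -> cont E ->
  (forall q, q <> 0 -> is_derive csch_defect q (2 * sech_conical q - E q)) ->
  Lap lam E (2 * LapI lam sech_conical - lam * LapI lam csch_defect).
Proof.
intros Hl CE HE.
destruct (csch_defect_Alt 2 ltac:(lia)) as [g [G1 [G2 [b Hb]]]].
assert (w0 : csch_defect 0 = 0) by (rewrite G2; ring).
assert (H : Lap lam (fun q => lam * csch_defect q - (2 * sech_conical q - E q)) (0 - (- exp (- lam * 0) * csch_defect 0))).
{ apply (Lap_ftc lam (fun q => - exp (- lam * q) * csch_defect q)).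
  - auto with cont.
  - apply (cont_ext (fun q => (-1) * (exp (- lam * q) * csch_defect q))); auto with cont; intros; ring.
  - intros q Hq; assert (D := HE q Hq).
    auto_derive; [eexists; exact D|].
    change (fun x => csch_defect x) with csch_defect; rewrite (is_derive_unique _ _ _ D); ring.
  - apply is_lim_seq_abs_0.
    apply (is_lim_seq_le_le (fun _ => 0) _
      (fun n => b O * (exp (- lam * INR n) * INR n ^ 1))).
    + intros n; split; [apply Rabs_pos|].
      rewrite Rabs_mult, Rabs_Ropp, (Rabs_pos_eq (exp _)) by apply Rlt_le, exp_pos.
      rewrite (Rmult_comm (b O)), Rmult_assoc.
      apply Rmult_le_compat_l; [apply Rlt_le, exp_pos|].
      rewrite G2, pow_1, Rabs_mult, (Rabs_pos_eq (INR n)) by apply pos_INR.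
      apply Rmult_le_compat_l; [apply pos_INR|].
      generalize (Hb 0%nat ltac:(lia) (INR n)) (Hb 1%nat ltac:(lia) (INR n)); simpl.
      intros; rewrite Rabs_pos_eq; lra.
    + apply is_lim_seq_const.
    + replace (Finite 0) with (Rbar_mult (b O) 0) by (simpl; f_equal; ring).
      now apply is_lim_seq_scal_l, lim_exp_pow. }
rewrite w0, Rmult_0_r, Rminus_0_r in H.
apply (Lap_ext _ (fun q => ((lam * csch_defect q - (2 * sech_conical q - E q)) + 2 * sech_conical q) - lam * csch_defect q));
  [intros; ring|].
replace (2 * LapI lam sech_conical) with (0 + 2 * LapI lam sech_conical) by ring.
apply Lap_minus; auto 9 with cont.
- apply Lap_plus; auto 9 with cont; apply Lap_scal; auto with cont; now apply Lap_sech_conical.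
- apply Lap_scal; auto with cont; now apply Lap_csch_defect.
Qed.

Lemma sign_even (j : nat) : (-1) ^ (2 * j * (2 * j + 1) / 2)%nat = (-1) ^ j.
Proof.
replace (2 * j * (2 * j + 1))%nat with ((2 * (j * j) + j) * 2)%nat by lia.
rewrite Nat.div_mul, pow_add, pow_1_even by lia; ring.
Qed.

Lemma sign_odd (j : nat) : (-1) ^ ((2 * j + 1) * (2 * j + 1 + 1) / 2)%nat = - (-1) ^ j.
Proof.
replace ((2 * j + 1) * (2 * j + 1 + 1))%nat with ((2 * (j * j + j) + (j + 1)) * 2)%nat by lia.
rewrite Nat.div_mul, pow_add, pow_1_even, pow_add by lia; simpl; ring.
Qed.

Lemma pow_m1_sqr (j : nat) : (-1) ^ j * (-1) ^ j = 1.
Proof. rewrite <- Rpow_mult_distr; replace (-1 * -1) with 1 by ring; apply pow1. Qed.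

Lemma Rabs_pow_m1 (j : nat) (x : R) : Rabs ((-1) ^ j * x) = Rabs x.
Proof. rewrite Rabs_mult, pow_1_abs; ring. Qed.

Lemma sum_n_m_div_minus (c d p : nat -> R) (l : nat) :
  @eq R (sum_n_m (fun k => (c k - d k) / p k) 1 l)
    (sum_n_m (fun k => c k / p k) 1 l - sum_n_m (fun k => d k / p k) 1 l).
Proof.
induction l as [|l IH].
- rewrite !sum_n_m_zero by lia; unfold zero; simpl; ring.
- rewrite !sum_n_m_S, IH; unfold Rdiv; ring.
Qed.

(** A candidate for the error of order [l], described without [alpha]. The first and third clauses
    determine [rho] by uniqueness of expansions; the second is the sign sought. *)
Definition signed_remainder (l : nat) (rho : nat -> R) : Prop :=
  Poly l (fun n => Psi (4 * INR (n + 1)) - rho n) /\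
  (forall n, (-1) ^ (l * (l + 1) / 2)%nat * rho n < 0) /\
  exists B, forall n, Rabs (rho n) <= B / INR (n + 1) ^ (l + 1).

Lemma Lap_pow0 (lam : R) (f : R -> R) (I : R) : Lap lam f I -> Lap lam (fun q => q ^ 0 * f q) I.
Proof. apply Lap_ext; intros; simpl; ring. Qed.

(** Keep [j] terms of [w], giving powers of [1/N] up to [2 j], and [j + 1] terms of [y], up to
    [2 j + 1]. The extra term flips the sign of the remainder of [y], which cancels the minus sign
    in [w - y]. *)
Lemma remainder_odd (j : nat) : exists rho, signed_remainder (2 * j + 1) rho.
Proof.
set (J := S (S (S j))).
destruct (csch_defect_Alt J ltac:(unfold J; lia)) as [g [G1 [G2 [b Hb]]]].
destruct (alt_sech_conical J) as [a [Ha Ha']].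
set (W := fun n => LapI (4 * INR (n + 1)) csch_defect).
set (Y := fun n => LapI (4 * INR (n + 1)) sech_conical).
assert (HW : forall n, Lap (4 * INR (n + 1)) (fun q => q ^ 1 * g q) (W n)).
{ intros n; assert (HN := Nn_ge1 n).
  eapply Lap_ext; [|apply Lap_csch_defect; lra]; intros q _; simpl; rewrite G2; ring. }
assert (HY : forall n, Lap (4 * INR (n + 1)) (fun q => q ^ 0 * sech_conical q) (Y n)).
{ intros n; assert (HN := Nn_ge1 n); apply Lap_pow0, Lap_sech_conical; lra. }
set (RW := fun n => lrem b 1 (4 * INR (n + 1)) (W n) j).
set (RY := fun n => lrem a 0 (4 * INR (n + 1)) (Y n) (S j)).
destruct (lrem_bound J b g 1 W j (2 * j + 1 + 1) G1 Hb HW ltac:(unfold J; lia) ltac:(lia))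
  as [B1 [HB1 E1]].
destruct (lrem_bound J a sech_conical 0 Y (S j) (2 * j + 1 + 1) sech_conical_cont Ha HY ltac:(unfold J; lia) ltac:(lia))
  as [B2 [HB2 E2]].
exists (fun n => (-1) ^ j * (RW n + RY n)); split; [|split].
- apply (Poly_ext _ (fun n => (-1) * ((Y n - (-1) ^ S j * RY n) / INR (n + 1) ^ 0) +
     (W n - (-1) ^ j * RW n) / INR (n + 1) ^ 0)).
  + intros n; unfold Psi; fold (W n) (Y n); simpl; field.
  + apply Poly_lin; apply Poly_lrem; lia.
- intros n; rewrite sign_odd; assert (HN := Nn_ge1 n).
  assert (0 < RY n).
  { apply (lrem_gt0 J a sech_conical); auto with cont; [lra|].
    intros q Hq; apply Ha'; auto; unfold J; lia. }
  assert (0 <= RW n) by (specialize (E1 n); apply E1).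
  replace (- (-1) ^ j * ((-1) ^ j * (RW n + RY n))) with
    (- ((-1) ^ j * (-1) ^ j) * (RW n + RY n)) by ring.
  rewrite pow_m1_sqr; lra.
- exists (B1 + B2); intros n; rewrite Rabs_pow_m1.
  specialize (E1 n); specialize (E2 n); fold (RW n) in E1; fold (RY n) in E2.
  rewrite Rabs_pos_eq by lra; unfold Rdiv in *; lra.
Qed.

(** With [j] terms each, the remainders of [w] and [y] would be subtracted. Eliminating the
    transform of [w] through that of [E], called [Z n], gives [Psi = - ((1 - 1/(2 N)) Y + Z/(4 N))],
    where both coefficients inside are positive. *)
Lemma remainder_even (j : nat) : exists rho, signed_remainder (2 * j) rho.
Proof.
set (J := S (S (S j))).
destruct (csch_defect_derive_alt J ltac:(unfold J; lia)) as [E [CE [[d Hd] HE]]].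
destruct (alt_sech_conical J) as [a [Ha Ha']].
set (Y := fun n => LapI (4 * INR (n + 1)) sech_conical).
set (Z := fun n => 2 * Y n - 4 * INR (n + 1) * LapI (4 * INR (n + 1)) csch_defect).
assert (HZ : forall n, Lap (4 * INR (n + 1)) (fun q => q ^ 0 * E q) (Z n)).
{ intros n; assert (HN := Nn_ge1 n); apply Lap_pow0, Lap_csch_defect_by_parts; auto; lra. }
assert (HY : forall n, Lap (4 * INR (n + 1)) (fun q => q ^ 0 * sech_conical q) (Y n)).
{ intros n; assert (HN := Nn_ge1 n); apply Lap_pow0, Lap_sech_conical; lra. }
set (RZ := fun n => lrem d 0 (4 * INR (n + 1)) (Z n) j).
set (RY := fun n => lrem a 0 (4 * INR (n + 1)) (Y n) j).
destruct (lrem_bound J d E 0 Z j (2 * j + 1) CE Hd HZ ltac:(unfold J; lia) ltac:(lia))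
  as [B1 [HB1 E1]].
destruct (lrem_bound J a sech_conical 0 Y j (2 * j + 1) sech_conical_cont Ha HY ltac:(unfold J; lia) ltac:(lia))
  as [B2 [HB2 E2]].
assert (HI : forall n, 0 < / INR (n + 1) <= 1).
{ intros n; assert (HN := Nn_ge1 n); split; [apply Rinv_0_lt_compat; lra|].
  rewrite <- Rinv_1; apply Rinv_le_contravar; lra. }
exists (fun n => (-1) ^ j * - ((1 - 1 / 2 * / INR (n + 1)) * RY n + 1 / 4 * / INR (n + 1) * RZ n));
  split; [|split].
- apply (Poly_ext _ (fun n => (-1) * ((Y n - (-1) ^ j * RY n) / INR (n + 1) ^ 0) +
    (1 / 2 * ((Y n - (-1) ^ j * RY n) / INR (n + 1) ^ 1) +
     (- (1 / 4) * ((Z n - (-1) ^ j * RZ n) / INR (n + 1) ^ 1) + 0)))).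
  + intros n; assert (HN := Nn_ge1 n); unfold Psi; fold (Y n).
    replace (LapI (4 * INR (n + 1)) csch_defect) with ((2 * Y n - Z n) / (4 * INR (n + 1)))
      by (unfold Z; field; lra).
    simpl; field; lra.
  + repeat apply Poly_lin; try apply Poly_0; apply Poly_lrem; lia.
- intros n; rewrite sign_even; assert (HN := Nn_ge1 n).
  assert (HRY : 0 < RY n).
  { apply (lrem_gt0 J a sech_conical); auto with cont; [lra|].
    intros q Hq; apply Ha'; auto; unfold J; lia. }
  assert (HRZ : 0 <= RZ n) by (specialize (E1 n); apply E1).
  specialize (HI n).
  rewrite <- Rmult_assoc, pow_m1_sqr.
  assert (0 < (1 - 1 / 2 * / INR (n + 1)) * RY n) by (apply Rmult_lt_0_compat; lra).
  assert (0 <= 1 / 4 * / INR (n + 1) * RZ n) by (apply Rmult_le_pos; lra).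
  lra.
- exists (B1 + B2); intros n; rewrite Rabs_pow_m1, Rabs_Ropp.
  specialize (E1 n); specialize (E2 n); specialize (HI n).
  fold (RZ n) in E1; fold (RY n) in E2.
  assert (T1 : 0 <= (1 - 1 / 2 * / INR (n + 1)) * RY n <= RY n) by (split; nra).
  assert (T2 : 0 <= 1 / 4 * / INR (n + 1) * RZ n <= RZ n) by (split; nra).
  rewrite Rabs_pos_eq by lra; unfold Rdiv in *; lra.
Qed.

Theorem theorem2 (alpha : nat -> R) (Halpha : is_landau_expansion alpha)
  (l n : nat) :
  (-1) ^ (l * (l + 1) / 2)%nat * landau_error alpha l n < 0.
Proof.
assert (HR : exists rho, signed_remainder l rho).
{ destruct (Nat.Even_or_Odd l) as [[j ->]|[j ->]].
  - apply remainder_even.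
  - apply remainder_odd. }
destruct HR as [rho [[c Hc] [Hs [B HB]]]].
destruct (Halpha l) as [B' HB'].
assert (E : forall n, landau_error alpha l n =
   sum_n_m (fun k => (c k - alpha k) / INR (n + 1) ^ k) 1 l + rho n).
{ clear n; intros n; rewrite landau_error_split, (landau_error0_Psi alpha Halpha).
  specialize (Hc n); cbv beta in Hc.
  rewrite (sum_n_m_div_minus c alpha (fun k => INR (n + 1) ^ k)); lra. }
assert (U : forall k, (1 <= k <= l)%nat -> c k - alpha k = 0).
{ apply (asymptotic_unique l (fun k => c k - alpha k) (B + B')).
  eapply filter_imp; [|exact HB']; intros m Hm; cbv beta in Hm.
  specialize (HB m); rewrite E in Hm.
  unfold Rdiv; rewrite Rmult_plus_distr_r; fold (B / INR (m + 1) ^ (l + 1)).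
  fold (B' / INR (m + 1) ^ (l + 1)).
  set (S := sum_n_m _ _ _) in *.
  replace S with ((S + rho m) - rho m) by ring.
  eapply Rle_trans; [apply Rabs_triang|]; rewrite Rabs_Ropp; lra. }
replace (landau_error alpha l n) with (rho n); [apply Hs|].
rewrite E, (sum_n_m_ext_loc _ (fun _ => 0)).
- rewrite (sum_n_m_const_zero (G := R_AbelianMonoid)); unfold zero; simpl; ring.
- intros k Hk; rewrite U by auto; apply Rmult_0_l.
Qed.
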